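(* Let $1\le p\le n-1$. Let $(\theta_1,\dots,\theta_{n-p})$ be random with law $$\mathrm{cst}\,\prod_{1\le k<l\le n-p}|e^{i\theta_k}-e^{i\theta_l}|^2\prod_{j=1}^{n-p}|1-e^{i\theta_j}|^{2p}\,d\theta_1\cdots d\theta_{n-p}$$ on $(-\pi,\pi)^{n-p}$ ($\mathrm{cst}$ being the normalization constant), and let $Z_U^{(p)}=p!\prod_{k=1}^{n-p}(1-e^{i\theta_k})$. Then $|Z_U^{(p)}|$ has a density $h_n^{(U)}$ on $(0,\infty)$ such that, for some constant $d(n)>0$ (depending on $n$ and $p$), $$h_n^{(U)}(\varepsilon)\ \sim\ d(n)\,\varepsilon^{2p}\qquad\text{as }\varepsilon\to0^+.$$
   Context: The law on the angles is the spectral law of the Haar measure on $U(n)$ conditioned to have $p$ eigenvalues equal to $1$ (the remaining eigenvalues being $e^{i\theta_1},\dots,e^{i\theta_{n-p}}$), and $Z_U^{(p)}$ is the $p$-th derivative at $x=1$ of the characteristic polynomial $\det(x\,\mathrm{Id}-u)=(x-1)^p\prod_{k=1}^{n-p}(x-e^{i\theta_k})$. *)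

(* Defs.v *)
From HB Require Import structures.
From mathcomp Require Import all_boot all_order all_algebra.
From mathcomp Require Import all_classical all_reals all_analysis.
From mathcomp.real_closed Require Import complex.
Import Order.TTheory GRing.Theory Num.Theory.
Import numFieldNormedType.Exports.

Set Implicit Arguments.
Unset Strict Implicit.
Unset Printing Implicit Defensive.

Local Open Scope classical_set_scope.
Local Open Scope ring_scope.

Section measure_cons.
Local Open Scope ereal_scope.
Context d (T : measurableType d) (R : realType) (m : nat).
Variables (mu : {sigma_finite_measure set T -> \bar R})
          (nu : {sigma_finite_measure set (m.-tuple T) -> \bar R}).

Definition tcons (z : T * m.-tuple T) : m.+1.-tuple T := [tuple of z.1 :: z.2].

Lemma measurable_tcons : measurable_fun [set: T * m.-tuple T] tcons.
Proof. exact: measurable_cons. Qed.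

Definition measure_cons : set (m.+1.-tuple T) -> \bar R :=
  pushforward (mu \x nu) tcons.

Let measure_cons0 : measure_cons set0 = 0.
Proof. by rewrite /measure_cons /pushforward preimage_set0 measure0. Qed.

Let measure_cons_ge0 A : 0 <= measure_cons A.
Proof. by rewrite /measure_cons /pushforward; exact: measure_ge0. Qed.

Let measure_cons_sigma_additive : semi_sigma_additive measure_cons.
Proof.
move=> F mF tF mUF; rewrite /measure_cons /pushforward preimage_bigcup.
have mtcons B : measurable B -> measurable (tcons @^-1` B).
  by move=> mB; rewrite -[_ @^-1` _]setTI; exact: measurable_tcons.
apply: measure_semi_sigma_additive.
- by move=> n; exact: mtcons.
- apply/trivIsetP => /= i j _ _ ij; rewrite -preimage_setI.
  by move/trivIsetP : tF => /(_ _ _ _ _ ij) ->//; rewrite preimage_set0.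
- by rewrite -preimage_bigcup; exact: mtcons.
Qed.

HB.instance Definition _ := isMeasure.Build _ _ _ measure_cons
  measure_cons0 measure_cons_ge0 measure_cons_sigma_additive.

Let measure_cons_sigma_finite : sigma_finite [set: _] measure_cons.
Proof.
have /sigma_finiteP[F [TF ndF Foo]] := sigma_finiteT mu.
have /sigma_finiteP[G [TG ndG Goo]] := sigma_finiteT nu.
pose u (t : m.+1.-tuple T) : T * m.-tuple T :=
  (thead t, [tuple of behead t]).
have uK : cancel tcons u.
  by case=> x t; congr (_, _); rewrite ?theadE//; exact: val_inj.
have mu_ : measurable_fun setT u.
  apply/measurable_fun_pairP; split; first exact: measurable_tnth.
  exact: measurable_behead.
exists (fun k => u @^-1` (F k `*` G k)).
  apply/seteqP; split=> // t _.
  have [i _ Fi] : (\bigcup_k F k) (u t).1 by rewrite -TF.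
  have [j _ Gj] : (\bigcup_k G k) (u t).2 by rewrite -TG.
  exists (maxn i j) => //; split.
  - by move: Fi; exact/subsetPset/ndF/leq_maxl.
  - by move: Gj; exact/subsetPset/ndG/leq_maxr.
move=> k; have [mF Fk] := Foo k; have [mG Gk] := Goo k; split.
  by rewrite -[_ @^-1` _]setTI; apply: mu_ => //; exact: measurableX.
rewrite /measure_cons /pushforward -comp_preimage (_ : u \o tcons = id).
  by rewrite preimage_id product_measure1E// lte_mul_pinfty// ge0_fin_numE.
exact/funext.
Qed.

HB.instance Definition _ :=
  Measure_isSigmaFinite.Build _ _ _ measure_cons measure_cons_sigma_finite.

End measure_cons.

(* The m-dimensional Lebesgue measure, as an iterated product of
   one-dimensional ones; lebesgue_tuple_box characterizes it. *)
Section lebesgue_tuple.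
Context (R : realType).
Notation RT := (measurableTypeR R).

Fixpoint lebesgue_tuple (m : nat) :
    {sigma_finite_measure set (m.-tuple RT) -> \bar R} :=
  match m with
  | 0 => dirac ([tuple] : 0.-tuple RT)
  | m'.+1 => measure_cons lebesgue_measure (lebesgue_tuple m')
  end.

Lemma lebesgue_tuple_box (m : nat) (A : 'I_m -> set RT) :
  (forall i, measurable (A i)) ->
  lebesgue_tuple m [set t | forall i, A i (tnth t i)] =
  (\prod_(i < m) lebesgue_measure (A i))%E.
Proof.
elim: m A => [|m IH] A mA.
  by rewrite big_ord0 /= diracE mem_set//= => -[].
rewrite big_ord_recl /= /measure_cons /pushforward.
set B := [set t : m.-tuple RT | forall i, A (lift ord0 i) (tnth t i)].
rewrite (_ : _ @^-1` _ = A ord0 `*` B); last first.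
  apply/seteqP; split=> -[x t] /=.
    by move=> H; split=> [|i]; [exact: (H ord0)|have := H (lift ord0 i); rewrite tnthS].
  move=> [H0 H] i; case: (unliftP ord0 i) => [j|] ->; last exact: H0.
  by rewrite tnthS; exact: H.
rewrite product_measure1E//; first by rewrite (IH (fun i => A (lift ord0 i))).
rewrite (_ : B = \bigcap_(i : 'I_m) ((@tnth _ RT ^~ i) @^-1` A (lift ord0 i))).
  apply: fin_bigcap_measurable => // i _.
  rewrite -[_ @^-1` _]setTI; exact: measurable_tnth.
by apply/seteqP; split=> t H i //=; exact: H.
Qed.

End lebesgue_tuple.

Section angles.
Context (R : realType).
Notation RT := (measurableTypeR R).

Definition expi (x : R) : R[i] := Complex (cos x) (sin x).

(* `|z| is an element of R[i] with zero imaginary part. *)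
Definition cmod (z : R[i]) : R := complex.Re `|z|.

Definition angle_cube (m : nat) : set (m.-tuple RT) :=
  [set t | forall j : 'I_m, tnth t j \in `]- pi, pi[].
Arguments angle_cube m : clear implicits.

Definition angle_weight (p m : nat) (t : m.-tuple RT) : R :=
  (\prod_(k < m) \prod_(l < m | (k < l)%N)
     cmod (expi (tnth t k) - expi (tnth t l)) ^+ 2) *
  \prod_(j < m) cmod (1 - expi (tnth t j)) ^+ (2 * p).

(* The constant normalizing angle_weight into a probability density on the
   cube. *)
Definition angle_cst (p m : nat) : R :=
  (fine (\int[lebesgue_tuple R m]_(t in angle_cube m)
           (angle_weight p t)%:E)%E)^-1.

Definition angle_law (p m : nat) (A : set (m.-tuple RT)) : \bar R :=
  (\int[lebesgue_tuple R m]_(t in A `&` angle_cube m)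
     (angle_cst p m * angle_weight p t)%:E)%E.

Definition ZU (p m : nat) (t : m.-tuple RT) : R[i] :=
  p`!%:R * \prod_(k < m) (1 - expi (tnth t k)).

(* A is not assumed included in D, so A = setT shows that X lies in D almost
   surely. *)
Definition has_density_on d (T : measurableType d) (P : probability T R)
    (X : T -> R) (D : set R) (h : R -> R) : Prop :=
  [/\ measurable_fun (D : set RT) (h : RT -> RT),
      forall x, D x -> 0 <= h x
    & forall A : set RT, measurable A ->
        P (X @^-1` A) = (\int[lebesgue_measure]_(x in A `&` D) (h x)%:E)%E].

End angles.

(* Main.v *)
(* Up to the factor p!, the modulus of Z is the product of the chords
   |1 - e^(i theta_j)| = 2 |sin (theta_j / 2)|, so the factor
   prod |1 - e^(i theta_j)|^(2p) of the law contributes exactly a constant times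
   eps^(2p), and it remains to show that under the measure
   V dtheta = prod_(k<l) |e^(i theta_k) - e^(i theta_l)|^2 dtheta the product of the
   chords has a density with a positive finite limit at 0+. By symmetry one may
   assume that the first chord is the smallest. Given the other angles, whose chords
   have product P, the change of variable y = 2 P sin (theta_1 / 2) gives the density
   explicitly, with a Jacobian of order 1 / P; the distances of e^(i theta_1) to the
   other points are at most twice the corresponding chords, so V contains a factor
   at most of order P^2, the integrand is bounded, and dominated convergence gives
   the limit, namely a positive multiple of the integral of V P over the remaining
   angles. *)

Require Import Defs.
From HB Require Import structures.
From mathcomp Require Import all_boot all_order all_algebra.
From mathcomp Require Import fingroup perm.
From mathcomp Require Import all_classical all_reals all_analysis.
From mathcomp Require Import measurable_realfun.
From mathcomp.real_closed Require Import complex.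
From mathcomp Require Import ring lra zify.
Import Order.TTheory GRing.Theory Num.Theory.
Import numFieldNormedType.Exports.

Set Implicit Arguments.
Unset Strict Implicit.
Unset Printing Implicit Defensive.

Local Open Scope classical_set_scope.
Local Open Scope ring_scope.

(** * Measures given by a density *)

Section density_measure.
Local Open Scope ereal_scope.
Context d (T : measurableType d) (R : realType).
Variables (mu : {measure set T -> \bar R}) (g : T -> R).
Hypotheses (mg : measurable_fun [set: T] g) (g0 : forall x, (0 <= g x)%R).

(* The proofs are arguments so that the measure instance can find them. *)
Definition mdensity of measurable_fun [set: T] g & (forall x, (0 <= g x)%R) :=
  fun A : set T => \int[mu]_(x in A) (g x)%:E.

Local Notation nu := (mdensity mg g0).

Let mdensity0 : nu set0 = 0.
Proof. by rewrite /mdensity integral_set0. Qed.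

Let mdensity_ge0 A : 0 <= nu A.
Proof. by apply: integral_ge0 => x _; rewrite lee_fin. Qed.

Let mdensity_sigma_additive : semi_sigma_additive nu.
Proof.
move=> F mF tF mUF; rewrite /mdensity ge0_integral_bigcup//.
- apply: is_cvg_ereal_nneg_natsum_cond => n _ _.
  by apply: integral_ge0 => x _; rewrite lee_fin.
- exact/measurable_EFinP/measurable_funTS.
- by move=> x _; rewrite lee_fin.
Qed.

HB.instance Definition _ := isMeasure.Build _ _ _ nu
  mdensity0 mdensity_ge0 mdensity_sigma_additive.

Import HBNNSimple.

(** Monotone convergence along simple approximations reduces the claim to a simple function, and
    linearity to a single level set, where it is the definition of [mdensity]. *)
Lemma ge0_integral_mdensity (f : T -> \bar R) :
  measurable_fun [set: T] f -> (forall x, 0 <= f x) ->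
  \int[nu]_x f x = \int[mu]_x (f x * (g x)%:E).
Proof.
move=> mf f0; pose f_ := nnsfun_approx measurableT mf.
have f_cvg x : (f_ n x)%:E @[n --> \oo] --> f x by exact: cvg_nnsfun_approx.
have f_nd x : {homo (fun n => (f_ n x)%:E) : a b / (a <= b)%N >-> a <= b}.
  by move=> a b ab; rewrite lee_fin; exact/lefP/nd_nnsfun_approx.
transitivity (limn (fun n => \int[nu]_x (f_ n x)%:E)).
  rewrite -monotone_convergence//=.
  - by apply: eq_integral => x _; apply/esym/cvg_lim => //; exact: f_cvg.
  - by move=> n; exact/measurable_EFinP.
  - by move=> n x _; rewrite lee_fin.
transitivity (limn (fun n => \int[mu]_x ((f_ n x)%:E * (g x)%:E))); last first.
  rewrite -monotone_convergence//=.
  - apply: eq_integral => x _; apply/cvg_lim => //.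
    by apply: cvgeZr => //; exact: f_cvg.
  - by move=> n; apply: emeasurable_funM => //; exact/measurable_EFinP.
  - by move=> n x _; rewrite mule_ge0// lee_fin.
  - by move=> x _ a b ab; rewrite lee_wpmul2r// ?lee_fin//; exact: f_nd.
congr (limn _); apply/funext => n.
under [LHS]eq_integral do rewrite fimfunE -fsumEFin//.
rewrite [LHS]ge0_integral_fsum//; last 2 first.
  - by move=> r; exact/measurable_EFinP/measurableT_comp.
  - by move=> k x _; rewrite EFinM nnfun_muleindic_ge0.
under [RHS]eq_integral.
  move=> x xD; rewrite fimfunE -fsumEFin// ge0_mule_fsuml; last first.
    by move=> r; rewrite EFinM nnfun_muleindic_ge0.
  over.
rewrite [RHS]ge0_integral_fsum//; last 2 first.
  - move=> r; apply: emeasurable_funM; last exact/measurable_EFinP.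
    by apply/measurable_EFinP; do 2 apply/measurableT_comp => //.
  - by move=> k x _; rewrite mule_ge0 ?lee_fin// -lee_fin EFinM nnfun_muleindic_ge0.
apply: eq_fsbigr => r _.
rewrite integralZl_indic_nnsfun// integral_indic// setIT.
(* The sum runs over all real values; a negative one has an empty level set. *)
have [r0|r0] := ltP r 0%R.
  rewrite preimage_nnfun0// measure0 mule0 integral0_eq// => x _.
  by rewrite indic0 mulr0 mul0e.
rewrite -[LHS]ge0_integralZl//; last 2 first.
- exact/measurable_EFinP/measurable_funTS.
- by move=> x _; rewrite lee_fin.
rewrite integral_mkcond; apply: eq_integral => x _.
by rewrite patchE indicE; case: ifPn => _; rewrite ?mulr1 ?mulr0 ?mul0e.
Qed.

End density_measure.

(** * The substitution [y = 2 Q sin (x / 2)] on [[0, pi]] *)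

Section half_angle_substitution.
Context (R : realType).
Implicit Types (x y Q : R).
Local Notation RT := (measurableTypeR R).
Local Notation mu := (@lebesgue_measure R).

Let phi Q : R -> R := fun x => Q * (2 * sin (x / 2)).
Let phi' Q : R -> R := fun x => Q * cos (x / 2).

Let continuous_halfcos Q : continuous (phi' Q).
Proof.
move=> x; rewrite /phi'; apply: cvgM; first exact: cvg_cst.
apply: (@continuous_comp _ _ _ (fun x => x / 2) cos); last exact: continuous_cos.
by apply: cvgM; [exact: cvg_id|exact: cvg_cst].
Qed.

Let continuous_halfsin Q : continuous (phi Q).
Proof.
move=> x; rewrite /phi; apply: cvgM; first exact: cvg_cst.
apply: cvgM; first exact: cvg_cst.
apply: (@continuous_comp _ _ _ (fun x => x / 2) sin); last exact: continuous_sin.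
by apply: cvgM; [exact: cvg_id|exact: cvg_cst].
Qed.

Let is_derive_halfsin Q x : is_derive x (1 : R) (phi Q) (phi' Q x).
Proof.
rewrite /phi /phi'; apply: is_derive_eq; rewrite /GRing.scale/=.
by field.
Qed.

Let measurable_halfsin Q : measurable_fun [set: RT] (phi Q : RT -> RT).
Proof. exact: continuous_measurable_fun (@continuous_halfsin Q). Qed.

Let measurable_halfcos Q :
  measurable_fun [set: RT] (phi' Q \_ `[0, pi] : RT -> RT).
Proof.
apply/(measurable_restrictT _ _).1 => //; apply: measurable_funTS.
exact: continuous_measurable_fun (@continuous_halfcos Q).
Qed.

Let halfcos_ge0 Q : 0 <= Q -> forall x, 0 <= (phi' Q \_ `[0, pi]) x.
Proof.
move=> Q0 x; rewrite patchE; case: ifPn => //; rewrite inE/= in_itv/= => /andP[x0 xpi].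
rewrite mulr_ge0// cos_ge0_pihalf//; have := pi_gt0 R.
by rewrite ler_pdivrMr// ler_pdivlMr// mulNr divfK//; move=> ?; apply/andP; split; lra.
Qed.

Let halfsin_ge Q (b : R) x : 0 < Q -> 0 <= b -> b < Q * 2 -> x \in `[0, pi] ->
  (b <= phi Q x) = (2 * asin (b / (Q * 2)) <= x).
Proof.
move=> Q0 b0 bQ; rewrite in_itv/= => /andP[x0 xpi].
have s1 : -1 <= b / (Q * 2) <= 1.
  by rewrite (@le_trans _ _ 0) ?divr_ge0 ?mulr_ge0 ?(ltW Q0)//= ler_pdivrMr ?mulr_gt0//
    mul1r ltW.
rewrite /phi mulrA mulrC -ler_pdivrMr ?mulr_gt0//.
rewrite -[leLHS]asinK ?in_itv//= [in RHS]mulrC -ler_pdivlMr//.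
rewrite !leNgt ltr_sin// in_itv/=; last by rewrite asin_geNpi2// asin_lepi2.
by apply/andP; split; lra.
Qed.

(** As long as the ray starts below [Q * 2], its preimage within [[0, pi]] is an interval [[a, pi]],
    because sine increases there, and the fundamental theorem of calculus evaluates the integral. *)
Let halfsin_ray Q (b : R) : 0 < Q ->
  mu (`[0, Q * 2] `&` `[b, +oo[) =
  (\int[mu]_(x in phi Q @^-1` `[b, +oo[) ((phi' Q \_ `[0, pi]) x)%:E)%E.
Proof.
(* Since [phi Q] is nonnegative on [[0, pi]], replacing [b] by its positive part changes neither
   side. *)
move=> Q0; pose b' := Num.max b 0.
have b'0 : 0 <= b' by rewrite le_max lexx orbT.
have -> : `[0, Q * 2] `&` `[b, +oo[ = `[b', Q * 2]%classic.
  by apply/seteqP; split => z /=; rewrite !in_itv/= ?andbT ge_max => H; lra.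
have phi0 x : x \in `[0, pi] -> 0 <= phi Q x.
  rewrite in_itv/= => /andP[x0 xpi]; rewrite !mulr_ge0// ?(ltW Q0)// sin_ge0_pi//.
  by have := pi_gt0 R => ?; apply/andP; split; lra.
transitivity (\int[mu]_(x in phi Q @^-1` `[b, +oo[ `&` `[0%R, pi]) (phi' Q x)%:E)%E;
  last first.
  by rewrite integral_mkcondr; apply: eq_integral => x _; rewrite !patchE; case: ifP.
rewrite lebesgue_measure_itv/= lte_fin; case: ifPn => [bQ|]; last first.
  (* Reaching a value at least [Q * 2] forces [sin (x / 2) = 1], and there the derivative
     [Q * cos (x / 2)] vanishes. *)
  rewrite -leNgt => Qb; rewrite integral0_eq// => x [/= + xpi].
  rewrite in_itv/= andbT => bx; congr EFin.
  have {}bx : b' <= phi Q x by rewrite ge_max bx phi0.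
  rewrite /phi' sin1cos0 ?mulr0//; apply/le_anti; rewrite sin_max/=.
  rewrite (le_trans _ (ler_norm _))// -(ler_pM2l Q0) mulr1 -(ler_pM2r (_ : 0 < 2))//.
  by rewrite -mulrA [sin _ * 2]mulrC (le_trans Qb).
pose a : R := 2 * asin (b' / (Q * 2)).
have b1 : -1 <= b' / (Q * 2) < 1.
  rewrite (@le_trans _ _ 0) ?divr_ge0 ?mulr_ge0 ?(ltW Q0)//=.
  by rewrite ltr_pdivrMr ?mulr_gt0// mul1r.
have a0 : 0 <= a.
  have /andP[/[dup] ? /le_trans sN1 /[dup] ? /ltW s1] := b1; have := pi_gt0 R => ?.
  rewrite /a mulr_ge0// leNgt -ltr_sin ?in_itv/= ?asin_geNpi2 ?asin_lepi2 ?s1 ?andbT//.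
    by rewrite sin0 asinK ?in_itv/= ?s1 ?andbT// -leNgt divr_ge0// mulr_ge0// ltW.
  by apply/andP; split; lra.
rewrite (_ : _ `&` _ = `[a, pi]%classic); last first.
  apply/seteqP; split => x /=.
    by rewrite in_itv/= andbT => -[bx xpi];
      rewrite in_itv/= -halfsin_ge// ge_max bx phi0//; case/andP: xpi.
  rewrite !in_itv/= andbT => /andP[ax xpi].
  have x0pi : x \in `[0, pi] by rewrite in_itv/= xpi (le_trans a0).
  by move: ax; rewrite -halfsin_ge// ge_max => /andP[].
rewrite (@continuous_FTC2 _ _ (phi Q)).
- rewrite /phi (_ : a / 2 = asin (b' / (Q * 2))); last by rewrite /a mulrC mulKf.
  rewrite asinK ?in_itv/=; last by case/andP: b1 => -> /ltW.
  rewrite sin_pihalf mulr1 -EFinB; congr (_ - _)%:E.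
  by rewrite mulrA mulrCA divff ?mulr1// mulf_neq0// gt_eqF.
- by have := asin_ltpi2 b1; rewrite /a; lra.
- apply: continuous_subspaceT => x; exact: continuous_halfcos.
- split.
  + by move=> x _; have [] := is_derive_halfsin Q x.
  + apply: cvg_at_right_filter; exact: continuous_halfsin.
  + apply: cvg_at_left_filter; exact: continuous_halfsin.
- by move=> x _; rewrite derive1E; have [] := is_derive_halfsin Q x.
Qed.

(** Both sides are measures in [B], and closed rays form a generating pi-system, of finite measure
    here because [[0, Q * 2]] is bounded; so [halfsin_ray] is enough. *)
Lemma mdensity_halfsin Q : 0 < Q -> forall B : set RT, measurable B ->
  mu (`[0, Q * 2] `&` B) = (\int[mu]_(x in phi Q @^-1` B) ((phi' Q \_ `[0, pi]) x)%:E)%E.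
Proof.
move=> Q0 B mB.
have m1 : measurable_fun [set: RT] (\1_(`[0, Q * 2]%classic : set RT) : RT -> R).
  exact: measurable_indic.
have m10 x : 0 <= (\1_(`[0, Q * 2]%classic : set RT) : RT -> R) x by [].
pose nu := mdensity mu (measurable_halfcos Q) (halfcos_ge0 (ltW Q0)).
pose phim_mixin := isMeasurableFun.Build _ _ RT RT (phi Q) (measurable_halfsin Q).
pose phim : {mfun RT >-> RT} := HB.pack (phi Q : RT -> RT) phim_mixin.
transitivity (mdensity mu m1 m10 B).
  by rewrite /mdensity integral_indic.
transitivity (pushforward nu phim B); last by [].
apply: (measure_unique [set A : set RT | exists x, A = `[x, +oo[%classic]
    (fun n : nat => `[(- n%:R)%R, +oo[%classic)) => //.
- exact: RGenCInfty.measurableE.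
- move=> _ _ [x ->] [y ->]; exists (Num.max x y).
  by apply/seteqP; split => z /=; rewrite !in_itv/= !andbT ge_max => /andP.
- by move=> n; eexists.
- rewrite -subTset => z _; exists (Num.trunc `|z|).+1 => //=.
  rewrite in_itv/= andbT lerNl ltW// (le_lt_trans (ler_norm _))// normrN.
  exact: truncnS_gt.
- move=> _ [b ->].
  rewrite /pushforward/= /nu /mdensity integral_indic//=.
  exact: halfsin_ray.
- move=> n /=; rewrite /mdensity integral_indic//.
  rewrite (le_lt_trans (le_measure _ _ _ (@subIsetl _ _ _)))//.
  + by rewrite inE; apply: measurableI => //; exact: measurable_itv.
  + by rewrite inE; exact: measurable_itv.
  + by rewrite /= lebesgue_measure_itv; case: ifP => // _; rewrite -EFinD ltry.
Qed.

(** By [mdensity_halfsin], the image under [phi Q] of the measure of density [phi' Q] on [[0, pi]]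
    is Lebesgue measure on [[0, Q * 2]]. *)
Lemma ge0_integral_halfsin Q (f : RT -> \bar R) : 0 < Q ->
  measurable_fun [set: RT] f -> (forall x, 0 <= f x)%E ->
  (\int[mu]_(x in `[0%R, pi]) (f (Q * (2 * sin (x / 2)))%R * (Q * cos (x / 2))%:E) =
   \int[mu]_(y in `[0%R, (Q * 2)%R]) f y)%E.
Proof.
move=> Q0 mf f0.
pose nu := mdensity mu (measurable_halfcos Q) (halfcos_ge0 (ltW Q0)).
have m1 : measurable_fun [set: RT] (\1_(`[0, Q * 2]%classic : set RT) : RT -> R).
  exact: measurable_indic.
have m10 x : 0 <= (\1_(`[0, Q * 2]%classic : set RT) : RT -> R) x by [].
pose phim_mixin := isMeasurableFun.Build _ _ RT RT (phi Q) (measurable_halfsin Q).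
pose phim : {mfun RT >-> RT} := HB.pack (phi Q : RT -> RT) phim_mixin.
transitivity (\int[pushforward nu phim]_y f y)%E.
  rewrite ge0_integral_pushforward//= preimage_setT ge0_integral_mdensity//; last first.
    exact: measurableT_comp mf (measurable_halfsin Q).
  rewrite [LHS]integral_mkcond; apply: eq_integral => x _ /=.
  by rewrite !patchE; case: ifPn; rewrite ?mule0.
transitivity (\int[mdensity mu m1 m10]_y f y)%E.
  apply: eq_measure_integral => // B mB _ /=.
  rewrite [RHS]/mdensity integral_indic//.
  by apply: esym; apply: mdensity_halfsin => //.
rewrite ge0_integral_mdensity// [RHS]integral_mkcond.
apply: eq_integral => x _ /=; rewrite patchE indicE.
by case: ifPn => _; rewrite ?mule0 ?mule1.
Qed.

End half_angle_substitution.

(** On nonnegative reals the inverse is the measurable power of exponent [-1]; both take the value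
    [0] at [0]. *)
Lemma measurable_fun_inv_ge0 d (T : measurableType d) (R : realType)
    (f : T -> measurableTypeR R) :
  measurable_fun [set: T] f -> (forall t, 0 <= f t) ->
  measurable_fun [set: T] (fun t => (f t)^-1 : measurableTypeR R).
Proof.
move=> mf f0; rewrite (_ : (fun _ => _) = (@powR R ^~ (-1)) \o f).
  apply: measurableT_comp mf; exact: measurable_powR.
by apply/funext => t /=; rewrite powR_inv1.
Qed.

(** * Chords and distances on the unit circle *)

Section chord.
Context (R : realType).
Implicit Types x y Q : R.
Local Notation RT := (measurableTypeR R).
Local Notation mu := (@lebesgue_measure R).

Lemma cmodE (z : R[i]) : cmod z = Num.sqrt (complex.Re z ^+ 2 + complex.Im z ^+ 2).
Proof. by rewrite /cmod normc_def. Qed.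

Lemma cmod_ge0 (z : R[i]) : 0 <= cmod z.
Proof. by rewrite cmodE sqrtr_ge0. Qed.

Lemma cmodM (z w : R[i]) : cmod (z * w) = cmod z * cmod w.
Proof.
rewrite !cmodE -sqrtrM ?addr_ge0 ?sqr_ge0//; congr Num.sqrt.
by case: z w => [a b] [c e] /=; ring.
Qed.

Lemma cmod_nat n : cmod (n%:R : R[i]) = n%:R.
Proof.
by rewrite cmodE raddfMn raddfMn/= mul0rn expr0n addr0 sqrtr_sqr ger0_norm.
Qed.

Lemma cmod_prod (I : Type) (s : seq I) (F : I -> R[i]) :
  cmod (\prod_(i <- s) F i) = \prod_(i <- s) cmod (F i).
Proof. exact: (big_morph _ cmodM (cmod_nat 1)). Qed.

Definition gap x y : R := cmod (expi x - expi y).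
Definition chord x : R := cmod (1 - expi x).

Lemma gap_ge0 x y : 0 <= gap x y. Proof. exact: cmod_ge0. Qed.
Lemma chord_ge0 x : 0 <= chord x. Proof. exact: cmod_ge0. Qed.

Lemma gap_sqr x y : gap x y ^+ 2 = (cos x - cos y) ^+ 2 + (sin x - sin y) ^+ 2.
Proof. by rewrite /gap cmodE sqr_sqrtr// addr_ge0 ?sqr_ge0. Qed.

Lemma gapC x y : gap x y = gap y x.
Proof.
apply/eqP; rewrite -(eqrXn2 (ltn0Sn 1)) ?gap_ge0// !gap_sqr; apply/eqP; ring.
Qed.

Lemma gap0 y : gap 0 y = chord y.
Proof. by rewrite /gap /chord /expi cos0 sin0. Qed.

Lemma chordE x : chord x = 2 * `|sin (x / 2)|.
Proof.
apply/eqP; rewrite -(eqrXn2 (ltn0Sn 1)) ?chord_ge0 ?mulr_ge0//.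
rewrite -gap0 gap_sqr cos0 sin0 exprMn real_normK ?num_real//.
(* The double angle formulas turn the squared distance into a polynomial in [cos (x / 2)] and
   [sin (x / 2)]. *)
have {1 2}-> : x = x / 2 *+ 2 by rewrite -mulr_natr divfK.
rewrite cos_mulr2n sin_mulr2n; have := cos2Dsin2 (x / 2).
set c := cos _; set s := sin _ => cs; apply/eqP.
have c2 : c ^+ 2 = 1 - s ^+ 2 by rewrite -cs addrK.
transitivity (4 * (1 - c ^+ 2) ^+ 2 + 4 * c ^+ 2 * s ^+ 2); first ring.
by rewrite c2; ring.
Qed.

Lemma chordN x : chord (- x) = chord x.
Proof. by rewrite !chordE mulNr sinN normrN. Qed.

Lemma chord0 : chord 0 = 0.
Proof. by rewrite chordE mul0r sin0 normr0 mulr0. Qed.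

Lemma chord_le2 x : chord x <= 2.
Proof. by rewrite chordE ler_piMr// sin_max. Qed.

(** Triangle inequality through the point [1] of the circle. *)
Lemma gap_le_chord x y : gap x y <= chord x + chord y.
Proof.
rewrite /gap /chord /cmod -raddfD /=.
have : `|expi x - expi y| <= `|1 - expi x| + `|1 - expi y|.
  have -> : expi x - expi y = (1 - expi y) - (1 - expi x).
    by rewrite opprB [RHS]addrC addrA subrK.
  by rewrite [leRHS]addrC ler_normB.
by rewrite lecE => /andP[].
Qed.

Lemma continuous_gap y : continuous (gap^~ y).
Proof.
have -> : gap^~ y = fun x => Num.sqrt ((cos x - cos y) ^+ 2 + (sin x - sin y) ^+ 2).
  by apply/funext => x; rewrite -gap_sqr sqrtr_sqr ger0_norm// gap_ge0.
move=> x; apply: cvg_comp; last exact: sqrt_continuous.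
apply: cvgD; rewrite expr2; apply: cvgM.
- by apply: cvgB; [exact: continuous_cos|exact: cvg_cst].
- by apply: cvgB; [exact: continuous_cos|exact: cvg_cst].
- by apply: cvgB; [exact: continuous_sin|exact: cvg_cst].
- by apply: cvgB; [exact: continuous_sin|exact: cvg_cst].
Qed.

Lemma continuous_chord : continuous chord.
Proof.
have -> : chord = gap^~ 0 by apply/funext => x; rewrite gapC gap0.
exact: continuous_gap.
Qed.

Lemma measurable_gap d (T : measurableType d) (f g : T -> RT) :
  measurable_fun [set: T] f -> measurable_fun [set: T] g ->
  measurable_fun [set: T] (fun t => gap (f t) (g t) : RT).
Proof.
move=> mf mg.
rewrite (_ : (fun _ => _) = Num.sqrt \o (fun t => (cos (f t) - cos (g t)) ^+ 2 + (sin (f t)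
  - sin (g t)) ^+ 2)).
  apply: measurableT_comp.
    apply: continuous_measurable_fun; exact: sqrt_continuous.
  have mcos : measurable_fun [set: RT] (@cos R : RT -> RT).
    apply: continuous_measurable_fun; exact: continuous_cos.
  have msin : measurable_fun [set: RT] (@sin R : RT -> RT).
    apply: continuous_measurable_fun; exact: continuous_sin.
  by apply: measurable_funD; apply: measurable_funX; apply: measurable_funB;
    exact: measurableT_comp.
by apply/funext => t /=; rewrite -gap_sqr sqrtr_sqr ger0_norm// gap_ge0.
Qed.

Lemma measurable_chord : measurable_fun [set: RT] (chord : RT -> RT).
Proof. apply: continuous_measurable_fun; exact: continuous_chord. Qed.

(* For [0 < y < 2 Q], [halfangle Q y] is the angle [x] in [(0, pi)] such that
   [Q * chord x = y], and [chord_jac Q y] is its derivative in [y]. *)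
Definition halfangle Q y : R := 2 * (asin \_ `]-1, 1[) (y / (Q * 2)).
Definition chord_jac Q y : R := (Q * Num.sqrt (1 - (y / (Q * 2)) ^+ 2))^-1.

Let half_pi x : x \in `]0, pi[ -> x / 2 \in `]0, pi / 2[.
Proof. by rewrite !in_itv/= => /andP[? ?]; apply/andP; split; lra. Qed.

Lemma chord_sin x : x \in `[0, pi] -> chord x = 2 * sin (x / 2).
Proof.
rewrite in_itv/= => /andP[? ?]; rewrite chordE ger0_norm// sin_ge0_pi//.
by apply/andP; split; lra.
Qed.

Lemma chord_pi x : x \in `]0, pi[ -> 0 < chord x < 2.
Proof.
move=> xpi; have /[!in_itv]/= /andP[? ?] := half_pi xpi; have ? := pi_gt0 R.
rewrite chord_sin ?(subset_itv_oo_cc xpi)// mulr_gt0//= ?sin_gt0_pihalf//; last exact/andP.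
have : sin (x / 2) < sin (pi / 2) by rewrite ltr_sin// in_itv/=; apply/andP; split; lra.
by rewrite sin_pihalf => ?; lra.
Qed.

Let chord_div Q x : 0 < Q -> x \in `]0, pi[ -> Q * chord x / (Q * 2) = sin (x / 2).
Proof.
move=> Q0 x0; rewrite chord_sin ?(subset_itv_oo_cc x0)//.
by rewrite mulrA mulrAC divff ?mul1r// mulf_neq0// gt_eqF.
Qed.

Lemma halfangleK Q x : 0 < Q -> x \in `]0, pi[ -> halfangle Q (Q * chord x) = x.
Proof.
move=> Q0 xpi; rewrite /halfangle chord_div// patchE mem_set; last first.
  have /[!in_itv]/= /andP[? ?] := half_pi xpi; have ? := pi_gt0 R.
  have /andP[] := chord_pi xpi; rewrite chord_sin ?(subset_itv_oo_cc xpi)// => c0 c2.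
  by rewrite /= in_itv/=; apply/andP; split; lra.
rewrite sinK; first by rewrite mulrC divfK.
by have := half_pi xpi; rewrite !in_itv/= => /andP[? ?]; apply/andP; split; lra.
Qed.

(** The radicand is [1 - sin (x / 2) ^+ 2 = cos (x / 2) ^+ 2] with a positive cosine, so [chord_jac]
    is inverse to the derivative [Q * cos (x / 2)] of [Q * chord x]. *)
Lemma chord_jacK Q x : 0 < Q -> x \in `]0, pi[ ->
  chord_jac Q (Q * chord x) * (Q * cos (x / 2)) = 1.
Proof.
move=> Q0 xpi; rewrite /chord_jac chord_div// -cos2sin2 sqrtr_sqr ger0_norm; last first.
  by have := half_pi xpi; rewrite in_itv/= => /andP[? ?]; rewrite cos_ge0_pihalf//;
    apply/andP; split; lra.
rewrite mulVf// mulf_neq0 ?gt_eqF//.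
by have := half_pi xpi; rewrite in_itv/= => /andP[? ?]; rewrite cos_gt0_pihalf//;
  apply/andP; split; lra.
Qed.

Lemma measurable_halfangle d (T : measurableType d) (f g : T -> RT) :
  measurable_fun [set: T] f -> measurable_fun [set: T] g -> (forall t, 0 <= f t) ->
  measurable_fun [set: T] (fun t => halfangle (f t) (g t) : RT).
Proof.
move=> mf mg f0; apply: measurable_funM => //.
(* The arcsine is continuous on the open interval, and the restriction in [halfangle] gives the
   value [0] elsewhere; hence measurability on the whole line. *)
apply: (@measurableT_comp _ _ _ _ _ _ (asin \_ `]-1, 1[ : RT -> RT)).
  apply/(measurable_restrictT _ _).1 => //; apply: open_continuous_measurable_fun.
    exact: interval_open.
  by move=> x; rewrite inE/= in_itv/=; exact: continuous_asin.
apply: measurable_funM => //; apply: measurable_fun_inv_ge0 => //.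
  exact: measurable_funM.
by move=> t; rewrite mulr_ge0.
Qed.

Lemma measurable_chord_jac d (T : measurableType d) (f g : T -> RT) :
  measurable_fun [set: T] f -> measurable_fun [set: T] g -> (forall t, 0 <= f t) ->
  measurable_fun [set: T] (fun t => chord_jac (f t) (g t) : RT).
Proof.
move=> mf mg f0; apply: measurable_fun_inv_ge0; last first.
  by move=> t; rewrite mulr_ge0// sqrtr_ge0.
apply: measurable_funM => //; apply: measurableT_comp.
  apply: continuous_measurable_fun; exact: sqrt_continuous.
apply: measurable_funB => //; apply: measurable_funX.
apply: measurable_funM => //; apply: measurable_fun_inv_ge0 => //.
  exact: measurable_funM.
by move=> t; rewrite mulr_ge0.
Qed.

End chord.

(** * Change of variable from an angle to a multiple of its chord *)

Section chord_substitution.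
Context (R : realType).
Local Notation RT := (measurableTypeR R).
Local Notation mu := (@lebesgue_measure R).
Local Open Scope ereal_scope.

(** The negative half is reflected onto the positive one, which preserves Lebesgue measure; the
    point [0] is negligible. *)
Let ge0_integral_sym (F : RT -> \bar R) : measurable_fun [set: RT] F -> (forall x, 0 <= F x) ->
  \int[mu]_(x in `](- pi)%R, pi[) F x = \int[mu]_(x in `]0%R, pi[) (F x + F (- x)%R).
Proof.
move=> mF F0.
have mN : measurable_fun [set: RT] (-%R : RT -> RT) by exact: oppr_measurable.
have mFN : measurable_fun [set: RT] (fun x => F (- x)%R) by exact: measurableT_comp mF mN.
have pi0 := pi_gt0 R.
have -> : `](- pi)%R, pi[%classic = `](- pi)%R, 0%R[ `|` `[0%R, pi[ :> set RT.
  apply/seteqP; split => x /=; rewrite !in_itv/=.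
    by move=> /andP[x1 x2]; have [?|?] := ltP x 0%R; [left|right]; apply/andP.
  by move=> [] /andP[? ?]; apply/andP; split; lra.
rewrite ge0_integral_setU//; last 2 first.
- exact: measurable_funTS.
- apply/disj_set2P; apply/seteqP; split => // x /=;
  rewrite !in_itv/= => -[] /andP[? ?] /andP[? ?]; lra.
rewrite -integral_itv_obnd_cbnd; last exact: measurable_funTS.
rewrite ge0_integralD//; try exact: measurable_funTS.
rewrite addeC; congr (_ + _).
rewrite (_ : `]0%R, pi[%classic = -%R @^-1` `](- pi)%R, 0%R[ :> set RT); last first.
  by apply/seteqP; split => x /=; rewrite !in_itv/= => /andP[? ?]; apply/andP; split; lra.
rewrite -(@ge0_integral_pushforward _ _ RT RT R -%R mN mu _ F)//; last exact: measurable_funTS.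
by apply: eq_measure_integral => // B mB _; apply: esym; apply: lebesgue_measureN.
Qed.

(** Each [y] in the open interval is [Q * chord x] for the two angles [halfangle Q y] and its
    opposite. Folding at [0] collects both, and [ge0_integral_halfsin], applied to the integrand on
    the right, brings in the Jacobian. *)
Lemma ge0_integral_chord (Q : R) (f : RT -> \bar R) (K : RT -> R) : (0 < Q)%R ->
  measurable_fun [set: RT] f -> (forall x, 0 <= f x) ->
  measurable_fun [set: RT] (K : RT -> RT) -> (forall x, 0 <= K x)%R ->
  \int[mu]_(x in `](- pi)%R, pi[) (f (Q * chord x)%R * (K x)%:E) =
  \int[mu]_(y in `]0%R, (Q * 2)%R[)
    (f y * (chord_jac Q y * (K (halfangle Q y) + K (- halfangle Q y)%R))%:E).
Proof.
move=> Q0 mf f0 mK K0.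
have jac0 y : (0 <= chord_jac Q y)%R by rewrite invr_ge0 mulr_ge0 ?sqrtr_ge0 ?(ltW Q0).
have mN : measurable_fun [set: RT] (-%R : RT -> RT) by exact: oppr_measurable.
have mh : measurable_fun [set: RT] (halfangle Q : RT -> RT).
  by apply: (@measurable_halfangle _ _ _ (cst Q) id) => // t; exact: ltW.
have mj : measurable_fun [set: RT] (chord_jac Q : RT -> RT).
  by apply: (@measurable_chord_jac _ _ _ (cst Q) id) => // t; exact: ltW.
pose H (y : RT) : \bar R := f y * (chord_jac Q y * (K (halfangle Q y) + K (- halfangle Q
  y)%R))%:E.
have mH : measurable_fun [set: RT] H.
  apply: emeasurable_funM => //; apply/measurable_EFinP; apply: measurable_funM => //.
  apply: measurable_funD; apply: measurableT_comp => //.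
  exact: measurableT_comp mN mh.
have H0 y : 0 <= H y.
  by rewrite mule_ge0// lee_fin mulr_ge0// addr_ge0.
rewrite ge0_integral_sym; last 2 first.
- apply: emeasurable_funM; last exact/measurable_EFinP.
  apply: measurableT_comp => //; apply: measurable_funM => //.
  exact: measurable_chord.
- by move=> x; rewrite mule_ge0// lee_fin.
pose f' := H \_ `]0%R, (Q * 2)%R[.
have mf' : measurable_fun [set: RT] f'.
  by apply/(measurable_restrictT _ _).1 => //; exact: measurable_funTS.
have f'0 y : 0 <= f' y by rewrite /f' patchE; case: ifP.
have := ge0_integral_halfsin Q0 mf' f'0.
rewrite [X in _ = X -> _]integral_mkcond [X in X = _ -> _]integral_mkcond => E.
rewrite [RHS]integral_mkcond [LHS]integral_mkcond.
transitivity (\int[mu]_x f' x); last first.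
  apply: eq_integral => y _; rewrite /f' !patchE.
  by case: ifPn.
rewrite [RHS](_ : _ = \int[mu]_x (f' \_ `[0%R, (Q * 2)%R]) x); last first.
  apply: eq_integral => y _; rewrite /f' !patchE.
  case: ifPn => [yin|]; last by case: ifP.
  rewrite mem_set//=; move: yin; rewrite inE/=; exact: subset_itv_oo_cc.
rewrite -E; apply: eq_integral => x _; rewrite !patchE.
case: ifPn => [|xpi].
  rewrite inE/= => xpi; rewrite ifT; last by rewrite inE/=; exact: subset_itv_oo_cc.
  have /andP[c0 c2] := chord_pi xpi.
  rewrite -chord_sin ?(subset_itv_oo_cc xpi)// /f' patchE ifT; last first.
    by rewrite inE/= in_itv/= mulr_gt0//= ltr_pM2l.
  rewrite /H halfangleK// chordN -ge0_muleDr ?lee_fin//.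
  rewrite -muleA -!EFinM -EFinD; congr (_ * _%:E).
  by rewrite mulrAC chord_jacK// mul1r.
(* Only [x = 0] and [x = pi] remain; they are sent to [0] and [Q * 2], where [f'] vanishes. *)
case: ifPn => //; rewrite inE/= => xcc.
rewrite /f' patchE ifF ?mul0e//; apply/negbTE; apply: contra xpi.
rewrite !inE/= -chord_sin// !in_itv/= => /andP[x0 x2].
move: xcc; rewrite in_itv/= => /andP[]; rewrite 2!le_eqVlt.
have -> : (0%R == x) = false.
  by apply/eqP => x0'; move: x0; rewrite -x0' chord0 mulr0 ltxx.
have -> //: (x == pi) = false.
  by apply/eqP => x2'; move: x2; rewrite x2' chordE sin_pihalf normr1 mulr1 ltxx.
by move=> /= -> ->.
Qed.

End chord_substitution.

(** * Lebesgue measure on tuples: boxes, permutations, Tonelli, positivity *)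

Section lebesgue_tuple_theory.
Context (R : realType).
Local Notation RT := (measurableTypeR R).
Local Notation mu := (@lebesgue_measure R).
Local Notation lam := (lebesgue_tuple R).

Definition box m (A : 'I_m -> set RT) : set (m.-tuple RT) :=
  [set t | forall i, A i (tnth t i)].

Lemma measurable_box m (A : 'I_m -> set RT) :
  (forall i, measurable (A i)) -> measurable (box A).
Proof.
move=> mA; rewrite (_ : box A = \bigcap_(i : 'I_m) ((@tnth _ RT ^~ i) @^-1` A i)).
  apply: fin_bigcap_measurable => // i _.
  by rewrite -[_ @^-1` _]setTI; exact: measurable_tnth.
by apply/seteqP; split=> t H i //=; exact: H.
Qed.

Lemma measurable_boxE m : @measurable _ (m.-tuple RT) =
  <<s [set box A | A in [set A : 'I_m -> set RT | forall i, measurable (A i)]] >>.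
Proof.
apply/seteqP; split; last first.
  apply: smallest_sub; first exact: sigma_algebra_measurable.
  by move=> _ [A mA <-]; exact: measurable_box.
apply: smallest_sub; first exact: smallest_sigma_algebra.
rewrite -bigcup_seq => _ [i _ [Y mY <-]]; apply: sub_sigma_algebra.
(* A cylinder over the coordinate [i] is the box whose other sides are the whole line. *)
exists (fun j => if j == i then Y else setT) => [j|]; first by case: ifP.
rewrite setTI; apply/seteqP; split => t /=; first by move/(_ i); rewrite eqxx.
by move=> Yt j; case: eqP => [->|].
Qed.

Lemma angle_cubeE m : @angle_cube R m = box (fun=> `](- pi)%R, pi[%classic : set RT) :> set
  (m.-tuple RT).
Proof. by []. Qed.

Lemma measurable_angle_cube m : measurable (@angle_cube R m).
Proof. by rewrite angle_cubeE; apply: measurable_box. Qed.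

Lemma angle_cube_lty m : (lam m (@angle_cube R m) < +oo)%E.
Proof.
rewrite angle_cubeE lebesgue_tuple_box//.
rewrite (eq_bigr (fun=> (pi *+ 2)%:E)) => [|i _]; first by rewrite prodEFin ltry.
by rewrite lebesgue_measure_itv/= lte_fin ifT -?EFinD ?opprK// gtrN// pi_gt0.
Qed.

Lemma measurable_tuple_map m k (s : 'I_k -> 'I_m) :
  measurable_fun [set: m.-tuple RT] (fun t => [tuple tnth t (s i) | i < k] : k.-tuple RT).
Proof.
apply/measurable_fun_tnthP => i.
rewrite (_ : _ \o _ = (fun t => tnth t (s i))); first exact: measurable_tnth.
by apply/funext => t /=; rewrite tnth_mktuple.
Qed.

(** Both sides are measures in [A], so boxes suffice, and permuting the sides leaves the product of
    their measures unchanged. *)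
Lemma lebesgue_tuple_perm m (s : {perm 'I_m}) (A : set (m.-tuple RT)) : measurable A ->
  lam m ((fun t => [tuple tnth t (s i) | i < m]) @^-1` A) = lam m A.
Proof.
pose pt := fun t : m.-tuple RT => [tuple tnth t (s i) | i < m] : m.-tuple RT.
pose pt_mixin := isMeasurableFun.Build _ _ _ _ pt (measurable_tuple_map s).
pose ptm : {mfun m.-tuple RT >-> m.-tuple RT} := HB.pack pt pt_mixin.
move=> mA; change (pushforward (lam m) ptm A = lam m A); symmetry.
apply: (measure_unique [set box A | A in [set A : 'I_m -> set RT | forall i, measurable (A i)]]
  (fun n => box (fun=> `[(- n%:R)%R, n%:R]%classic))) => //.
- exact: measurable_boxE.
- move=> _ _ [B mB <-] [C mC <-]; exists (fun i => B i `&` C i).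
    by move=> i; apply: measurableI; [exact: mB|exact: mC].
  apply/seteqP; split => t /=; first by move=> H; split => i; case: (H i).
  by move=> [H1 H2] i; split; [exact: H1|exact: H2].
- by move=> n; eexists; last reflexivity.
- rewrite -subTset => t _.
  exists (Num.trunc (\sum_(i < m) `|tnth t i|)).+1 => //= i; rewrite /= in_itv/= -ler_norml.
  rewrite (le_trans _ (ltW (truncnS_gt _)))// (bigD1 i)//= lerDl sumr_ge0//.
- move=> _ [B mB <-].
  have E : pt @^-1` box B = box (fun i => B ((s^-1)%g i)).
    apply/seteqP; split => t /= H i.
      by have := H ((s^-1)%g i); rewrite tnth_mktuple permKV.
    by rewrite tnth_mktuple; have := H (s i); rewrite permK.
  transitivity (lam m (box (fun i => B ((s^-1)%g i)))); last by rewrite -E.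
  rewrite [LHS]lebesgue_tuple_box// [RHS]lebesgue_tuple_box// [RHS](reindex_inj (@perm_inj
    _ s))/=.
  by apply: eq_bigr => i _; rewrite permK.
- move=> n /=; rewrite lebesgue_tuple_box//.
  rewrite (eq_bigr (fun=> (n%:R *+ 2)%:E)) => [|i _]; first by rewrite prodEFin ltry.
  rewrite lebesgue_measure_itv/= lte_fin; case: ifPn; first by rewrite -EFinD opprK.
  by rewrite -leNgt => n0; congr EFin; have := ler0n R n; lra.
Qed.

Lemma ge0_integral_tuple_perm m (s : {perm 'I_m}) (f : m.-tuple RT -> \bar R) :
  measurable_fun [set: m.-tuple RT] f -> (forall t, 0 <= f t)%E ->
  (\int[lam m]_t f [tuple tnth t (s i) | i < m] = \int[lam m]_t f t)%E.
Proof.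
move=> mf f0.
have /= := @ge0_integral_pushforward _ _ _ _ R _ (measurable_tuple_map s) (lam m) setT f
  measurableT mf.
rewrite preimage_setT => <-//.
apply: eq_measure_integral => [|mpt A mA _]; first exact: measurable_tuple_map.
exact: lebesgue_tuple_perm.
Qed.

(** The measure on the left is by construction an image of the product measure, so this is
    Tonelli. *)
Lemma ge0_integral_tcons m (f : m.+1.-tuple RT -> \bar R) :
  measurable_fun [set: m.+1.-tuple RT] f -> (forall t, 0 <= f t)%E ->
  (\int[lam m.+1]_t f t = \int[lam m]_t \int[mu]_x f (tcons (x, t)))%E.
Proof.
move=> mf f0.
have mc : measurable_fun [set: RT * m.-tuple RT] (@tcons _ RT m) := @measurable_tcons _ RT m.
transitivity (\int[pushforward (mu \x lam m) (@tcons _ RT m)]_t f t)%E; first by [].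
rewrite ge0_integral_pushforward// preimage_setT.
rewrite (@fubini_tonelli2 _ _ _ _ R mu (lam m) (f \o @tcons _ RT m))//;
  first exact: measurableT_comp mf mc.
by move=> z; exact: f0.
Qed.

(** A box whose sides are disjoint consecutive subintervals of [(0, 1)] has positive measure, and
    [f] is positive on it; a zero integral would make [f] vanish almost everywhere on this box. *)
Lemma integral_cube_gt0 m (f : m.-tuple RT -> R) :
  measurable_fun [set: m.-tuple RT] (f : m.-tuple RT -> RT) -> (forall t, 0 <= f t) ->
  (forall t, (forall i, 0 < tnth t i < 1) -> injective (tnth t) -> 0 < f t) ->
  (0 < \int[lam m]_(t in @angle_cube R m) (f t)%:E)%E.
Proof.
move=> mf f0 fgt0.
(* The denominator [m.+1] is nonzero also for [m = 0]. *)
pose a (k : nat) : R := k%:R / m.+1%:R.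
have aS k : a k < a k.+1 by rewrite ltr_pM2r// ltr_nat.
have a_le k l : (k <= l)%N -> a k <= a l by move=> kl; rewrite ler_pM2r// ler_nat.
pose B : set (m.-tuple RT) := box (fun i : 'I_m => `]a i, a i.+1[%classic).
have mB : measurable B by exact: measurable_box.
have Bin t : B t -> forall i, 0 < tnth t i < 1.
  move=> Bt i; have := Bt i; rewrite /= in_itv/= => /andP[h1 h2].
  rewrite (le_lt_trans _ h1) ?divr_ge0//= (lt_le_trans h2)//.
  by rewrite ler_pdivrMr// mul1r ler_nat ltnS ltnW.
have Bcube : B `<=` @angle_cube R m.
  move=> t /Bin Bt i; have /andP[h1 h2] := Bt i; have := pi_ge2 R => ?.
  by rewrite in_itv/=; apply/andP; split; lra.
have Bpos t : B t -> 0 < f t.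
  move=> Bt; apply: fgt0; first exact: Bin.
  have lt_tnth (i j : 'I_m) : (i < j)%N -> tnth t i < tnth t j.
    move=> ij; have := Bt i; have := Bt j; rewrite /= !in_itv/= => /andP[h1 _] /andP[_ h2].
    by rewrite (lt_le_trans h2)// (le_trans _ (ltW h1))// a_le.
  move=> i j tij; case: (ltngtP i j) => [/lt_tnth|/lt_tnth|]; rewrite ?tij ?ltxx//.
  by move=> ij; apply: ord_inj.
rewrite lt_neqAle integral_ge0 ?andbT//; last by move=> t _; rewrite lee_fin.
apply/eqP => I0.
have mfB : measurable_fun B (EFin \o f) by apply/measurable_EFinP; exact: measurable_funTS.
have /(ae_eq_integral_abs _ mB mfB) [N [mN N0 BN]] : (\int[lam m]_(t in B) `|(EFin \o f) t|
  = 0)%E.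
  apply/eqP; rewrite eq_le integral_ge0// andbT I0.
  under eq_integral do rewrite gee0_abs ?lee_fin//.
  apply: ge0_subset_integral => //.
  - exact: measurable_angle_cube.
  - by apply/measurable_EFinP; exact: measurable_funTS.
  - by move=> t _; rewrite lee_fin.
have : (lam m B <= 0)%E.
  rewrite -N0 le_measure ?inE//; apply: subset_trans BN => t Bt /= /(_ Bt) [] /eqP.
  by rewrite gt_eqF// Bpos.
rewrite lebesgue_tuple_box// (eq_bigr (fun i : 'I_m => (a i.+1 - a i)%:E)) => [|i _].
  rewrite prodEFin lee_fin leNgt prodr_gt0// => i _.
  by rewrite subr_gt0.
by rewrite lebesgue_measure_itv/= lte_fin aS.
Qed.

End lebesgue_tuple_theory.

(** * Symmetric weights and the choice of a smallest chord *)

Section weights.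
Context (R : realType).
Local Notation RT := (measurableTypeR R).
Local Notation mu := (@lebesgue_measure R).
Local Notation lam := (lebesgue_tuple R).

Definition vdm m (t : m.-tuple RT) : R :=
  \prod_(k < m) \prod_(l < m | (k < l)%N) gap (tnth t k) (tnth t l) ^+ 2.

Definition prodch m (t : m.-tuple RT) : R := \prod_(j < m) chord (tnth t j).

(** The product form gives measurability factor by factor. Several angles may tie for the smallest
    chord; [nmin] counts them. *)
Definition argmin_ind m (t : m.-tuple RT) (k : 'I_m) : R :=
  \prod_(j < m) (chord (tnth t k) <= chord (tnth t j))%R%:R.

Definition nmin m (t : m.-tuple RT) : R := \sum_(k < m) argmin_ind t k.

(* The weights [argmin_ind t k / nmin t] sum to [1] over [k]; by symmetry only the
   one of the first angle is needed. *)
Definition wt m (t : m.+1.-tuple RT) : R := argmin_ind t ord0 / nmin t.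

Lemma angle_weightE p m (t : m.-tuple RT) : angle_weight p t = vdm t * prodch t ^+ (2 * p).
Proof. by rewrite /angle_weight prodrXl. Qed.

Lemma cmod_ZU p m (t : m.-tuple RT) : cmod (ZU p t) = p`!%:R * prodch t.
Proof. by rewrite /ZU cmodM cmod_nat cmod_prod. Qed.

Lemma vdm_ge0 m (t : m.-tuple RT) : 0 <= vdm t.
Proof. by apply: prodr_ge0 => k _; apply: prodr_ge0 => l _; rewrite sqr_ge0. Qed.

Lemma prodch_ge0 m (t : m.-tuple RT) : 0 <= prodch t.
Proof. by apply: prodr_ge0 => k _; exact: chord_ge0. Qed.

Lemma argmin_indE m (t : m.-tuple RT) k :
  argmin_ind t k = [forall j, chord (tnth t k) <= chord (tnth t j)]%:R.
Proof.
rewrite /argmin_ind; case: forallP => [H|H].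
  by rewrite big1// => j _; rewrite H.
have [j Hj] : exists j, ~~ (chord (tnth t k) <= chord (tnth t j)).
  by apply/existsP; rewrite -negb_forall; apply/negP => /forallP.
by rewrite (bigD1 j)//= (negbTE Hj) mul0r.
Qed.

Lemma argmin_ind_ge0 m (t : m.-tuple RT) k : 0 <= argmin_ind t k.
Proof. by rewrite argmin_indE. Qed.

Lemma nmin_ge1 m (t : m.+1.-tuple RT) : 1 <= nmin t.
Proof.
have [k _ Hk] := @arg_minP _ R _ ord0 predT (fun k => chord (tnth t k)) isT.
rewrite /nmin (bigD1 k)//= argmin_indE.
have -> : [forall j, chord (tnth t k) <= chord (tnth t j)].
  by apply/forallP => j; exact: Hk.
by rewrite lerDl sumr_ge0// => j _; exact: argmin_ind_ge0.
Qed.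

Lemma nmin_gt0 m (t : m.+1.-tuple RT) : 0 < nmin t.
Proof. exact: lt_le_trans (nmin_ge1 t). Qed.

Lemma wt_ge0 m (t : m.+1.-tuple RT) : 0 <= wt t.
Proof. by rewrite divr_ge0 ?argmin_ind_ge0// ltW// nmin_gt0. Qed.

Lemma wt_le1 m (t : m.+1.-tuple RT) : wt t <= 1.
Proof.
rewrite ler_pdivrMr ?nmin_gt0// mul1r (le_trans _ (nmin_ge1 t))// argmin_indE.
by case: [forall _, _].
Qed.

Lemma measurable_vdm m : measurable_fun [set: m.-tuple RT] (@vdm m : _ -> RT).
Proof.
apply: measurable_prod => k _.
rewrite (_ : (fun _ => _) = fun t : m.-tuple RT => \prod_(l <- seq.filter (fun l : 'I_m =>
  (k < l)%N) (index_enum _)) gap (tnth t k) (tnth t l) ^+ 2).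
  by apply: measurable_prod => l _; apply: measurable_funX; apply: measurable_gap;
    exact: measurable_tnth.
by apply/funext => t; rewrite big_filter.
Qed.

Lemma measurable_prodch m : measurable_fun [set: m.-tuple RT] (@prodch m : _ -> RT).
Proof.
apply: measurable_prod => k _; apply: measurableT_comp; first exact: measurable_chord.
exact: measurable_tnth.
Qed.

Lemma measurable_boolR d (T : measurableType d) (b : T -> bool) :
  measurable_fun [set: T] b -> measurable_fun [set: T] (fun t => (b t)%:R : RT).
Proof.
move=> mb; rewrite (_ : (fun _ => _) = (fun t => if b t then 1 else 0 : RT)).
  exact: measurable_fun_if.
by apply/funext => t; case: (b t).
Qed.

Lemma measurable_argmin_ind m (k : 'I_m) :
  measurable_fun [set: m.-tuple RT] (fun t => argmin_ind t k : RT).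
Proof.
apply: measurable_prod => j _; apply: measurable_boolR.
by apply: measurable_fun_ler; (apply: measurableT_comp;
  [exact: measurable_chord|exact: measurable_tnth]).
Qed.

Lemma measurable_nmin m : measurable_fun [set: m.-tuple RT] (@nmin m : _ -> RT).
Proof. by apply: measurable_sum => k; exact: measurable_argmin_ind. Qed.

Lemma measurable_wt m : measurable_fun [set: m.+1.-tuple RT] (@wt m : _ -> RT).
Proof.
apply: measurable_funM; first exact: measurable_argmin_ind.
apply: measurable_fun_inv_ge0; first exact: measurable_nmin.
by move=> t; exact: ltW (nmin_gt0 t).
Qed.

Section permutation.
Variables (m : nat) (s : {perm 'I_m}) (t : m.-tuple RT).
Let pt : m.-tuple RT := [tuple tnth t (s i) | i < m].

Lemma prodch_perm : prodch pt = prodch t.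
Proof.
rewrite /prodch [RHS](reindex_inj (@perm_inj _ s)).
by apply: eq_bigr => j _; rewrite tnth_mktuple.
Qed.

Lemma argmin_ind_perm k : argmin_ind pt k = argmin_ind t (s k).
Proof.
rewrite /argmin_ind [RHS](reindex_inj (@perm_inj _ s)).
by apply: eq_bigr => j _; rewrite !tnth_mktuple.
Qed.

Lemma nmin_perm : nmin pt = nmin t.
Proof.
rewrite /nmin [RHS](reindex_inj (@perm_inj _ s)).
by apply: eq_bigr => j _; rewrite argmin_ind_perm.
Qed.

End permutation.

(* In this form, over all ordered pairs of distinct indices, the symmetry of
   [vdm] is plain. *)
Lemma vdm_sqr m (t : m.-tuple RT) :
  vdm t ^+ 2 = \prod_(k < m) \prod_(l < m | l != k) gap (tnth t k) (tnth t l) ^+ 2.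
Proof.
rewrite expr2 {2}/vdm (exchange_big_dep xpredT)//= -big_split/=; apply: eq_bigr => k _.
rewrite [RHS](bigID (fun l : 'I_m => (k < l)%N))/=; congr (_ * _).
  by apply: eq_bigl => l; rewrite -val_eqE/= neq_ltn; case: ltngtP.
apply: eq_big => [l|l _]; last by rewrite gapC.
by rewrite -val_eqE/= neq_ltn; case: ltngtP.
Qed.

Lemma vdm_perm m (s : {perm 'I_m}) (t : m.-tuple RT) : vdm [tuple tnth t (s i) | i < m] =
  vdm t.
Proof.
apply/eqP; rewrite -(eqrXn2 (ltn0Sn 1)) ?vdm_ge0// !vdm_sqr.
rewrite [eqbRHS](reindex_inj (@perm_inj _ s)); apply/eqP; apply: eq_bigr => k _.
rewrite [RHS](reindex_inj (@perm_inj _ s)); apply: eq_big => [l|l _].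
  by rewrite (inj_eq (@perm_inj _ s)).
by rewrite !tnth_mktuple.
Qed.

(** Inserting the weights of all the angles, which sum to [1], splits the integral into [m.+1]
    terms; exchanging the first angle with the angle [k] shows that they are all equal. *)
Lemma ge0_integral_wt m (F : m.+1.-tuple RT -> \bar R) :
  measurable_fun [set: m.+1.-tuple RT] F -> (forall t, 0 <= F t)%E ->
  (forall (s : {perm 'I_m.+1}) t, F [tuple tnth t (s i) | i < m.+1] = F t) ->
  (\int[lam m.+1]_t F t = m.+1%:R%:E * \int[lam m.+1]_t (F t * (wt t)%:E))%E.
Proof.
move=> mF F0 Fs.
have mFw : measurable_fun [set: m.+1.-tuple RT] (fun t => F t * (wt t)%:E)%E.
  by apply: emeasurable_funM => //; apply/measurable_EFinP; exact: measurable_wt.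
pose s k : {perm 'I_m.+1} := tperm ord0 k.
pose pt k (t : m.+1.-tuple RT) : m.+1.-tuple RT := [tuple tnth t (s k i) | i < m.+1].
have Fw0 t : (0 <= F t * (wt t)%:E)%E by rewrite mule_ge0// lee_fin wt_ge0.
transitivity (\int[lam m.+1]_t (\sum_(k < m.+1) (F (pt k t) * (wt (pt k t))%:E)))%E.
  apply: eq_integral => t _.
  rewrite (eq_bigr (fun k => F t * (argmin_ind t k / nmin t)%:E)%E) => [|k _]; last first.
    by rewrite Fs /wt argmin_ind_perm nmin_perm /s tpermL.
  rewrite -ge0_sume_distrr ?sumEFin; last first.
    by move=> k _; rewrite lee_fin divr_ge0 ?argmin_ind_ge0// ltW// nmin_gt0.
  by rewrite -mulr_suml divff ?mule1// gt_eqF// nmin_gt0.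
rewrite ge0_integral_sum//; last first.
  move=> k; exact: measurableT_comp mFw (measurable_tuple_map (s k)).
rewrite (eq_bigr (fun=> \int[lam m.+1]_t (F t * (wt t)%:E))%E) => [|k _]; last first.
  exact: (@ge0_integral_tuple_perm _ _ (s k) (fun t => F t * (wt t)%:E)%E).
rewrite big_const_ord iter_addr_0.
exact: esym (mule_natl _ _).
Qed.

End weights.

(** * The density of the product of chords given all angles but the first *)

Section kernel.
Context (R : realType).
Local Notation RT := (measurableTypeR R).
Local Notation mu := (@lebesgue_measure R).
Local Notation lam := (lebesgue_tuple R).

Definition vdm_wt m (t : m.+1.-tuple RT) : R := vdm t * wt t.

(* Density at [y] of [q * prodch (tcons (x, t))], when [x] in [(-pi, pi)] has
   density [vdm_wt (tcons (x, t))] and [t] is fixed; the two summands are the two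
   solutions [x] and [- x]. *)
Definition kern m (q y : R) (t : m.-tuple RT) : R :=
  let Q := q * prodch t in
  (0 < y < Q * 2)%R%:R * (chord_jac Q y *
    (vdm_wt (tcons (halfangle Q y, t)) + vdm_wt (tcons (- halfangle Q y, t)))).

Lemma tnth_tcons0 m x (t : m.-tuple RT) : tnth (tcons (x, t)) ord0 = x.
Proof. by []. Qed.

Lemma tnth_tconsS m x (t : m.-tuple RT) j : tnth (tcons (x, t)) (lift ord0 j) = tnth t j.
Proof. by rewrite tnthS. Qed.

Lemma prodch_tcons m x (t : m.-tuple RT) : prodch (tcons (x, t)) = chord x * prodch t.
Proof.
rewrite /prodch big_ord_recl tnth_tcons0; congr (_ * _).
by apply: eq_bigr => j _; rewrite tnth_tconsS.
Qed.

Lemma vdm_tcons m x (t : m.-tuple RT) :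
  vdm (tcons (x, t)) = (\prod_(j < m) gap x (tnth t j) ^+ 2) * vdm t.
Proof.
rewrite /vdm big_ord_recl; congr (_ * _).
  rewrite big_mkcond big_ord_recl /= mul1r; apply: eq_bigr => j _.
  by rewrite tnth_tcons0 tnth_tconsS.
apply: eq_bigr => k _; rewrite big_mkcond big_ord_recl /= mul1r [RHS]big_mkcond.
by apply: eq_bigr => l _; rewrite !tnth_tconsS.
Qed.

Lemma angle_cube_tcons m x (t : m.-tuple RT) :
  (tcons (x, t) \in @angle_cube R m.+1) = (x \in `]- pi, pi[) && (t \in @angle_cube R m).
Proof.
apply/idP/andP => [/set_mem H|[H0 /set_mem H]].
  split; first exact: (H ord0).
  by apply/mem_set => j; have := H (lift ord0 j); rewrite tnth_tconsS.
by apply/mem_set => i; case: (unliftP ord0 i) => [j|] ->//; rewrite tnth_tconsS; exact: H.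
Qed.

Lemma argmin_tcons m x (t : m.-tuple RT) :
  argmin_ind (tcons (x, t)) ord0 = [forall j, chord x <= chord (tnth t j)]%:R.
Proof.
rewrite argmin_indE tnth_tcons0; congr (nat_of_bool _)%:R.
apply/forallP/forallP => [H j|H i]; first by have := H (lift ord0 j); rewrite tnth_tconsS.
by case: (unliftP ord0 i) => [j|] ->//; rewrite tnth_tconsS.
Qed.

Lemma vdm_wt_ge0 m (t : m.+1.-tuple RT) : 0 <= vdm_wt t.
Proof. by rewrite mulr_ge0 ?vdm_ge0 ?wt_ge0. Qed.

(* Where [x] has the smallest chord, [gap x y <= chord x + chord y <= 2 * chord y]. *)
Lemma vdm_wt_le m x (t : m.-tuple RT) :
  vdm_wt (tcons (x, t)) <= 4 ^+ m * prodch t ^+ 2 * vdm t *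
    [forall j, chord x <= chord (tnth t j)]%:R.
Proof.
rewrite /vdm_wt; case: forallP => [H|H]; last first.
  rewrite mulr0 /wt argmin_tcons (_ : [forall _, _] = false) ?mul0r ?mulr0//.
  by apply/negbTE/negP => /forallP.
rewrite mulr1 (le_trans (ler_piMr (vdm_ge0 _) (wt_le1 _)))// vdm_tcons.
have -> : (4 : R) ^+ m = \prod_(j < m) 4 by rewrite prodr_const card_ord.
rewrite ler_wpM2r ?vdm_ge0// /prodch -prodrXl -big_split/=.
apply: ler_prod => j _; rewrite sqr_ge0/=.
have -> : (4 : R) = 2 ^+ 2 by rewrite expr2; lra.
rewrite -exprMn ler_pXn2r ?nnegrE ?gap_ge0 ?mulr_ge0 ?chord_ge0//.
by rewrite (le_trans (gap_le_chord _ _))// mulr_natl mulr2n lerD2r H.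
Qed.

(** The bound [vdm_wt_le] carries the factor [prodch t ^+ 2]. *)
Lemma vdm_wt_eq0 m x (t : m.-tuple RT) : prodch t = 0 -> vdm_wt (tcons (x, t)) = 0.
Proof.
move=> t0; apply/le_anti; rewrite vdm_wt_ge0 andbT.
by have := vdm_wt_le x t; rewrite t0 expr0n/= mulr0 !mul0r.
Qed.

Lemma chord_jac_ge0 (Q y : R) : 0 <= Q -> 0 <= chord_jac Q y.
Proof. by move=> Q0; rewrite invr_ge0 mulr_ge0 ?sqrtr_ge0. Qed.

Lemma kern_ge0 m q y (t : m.-tuple RT) : 0 <= q -> 0 <= kern q y t.
Proof.
move=> q0; rewrite /kern mulr_ge0// mulr_ge0 ?addr_ge0 ?vdm_wt_ge0//.
by rewrite chord_jac_ge0// mulr_ge0// prodch_ge0.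
Qed.

Lemma measurable_vdm_wt m : measurable_fun [set: m.+1.-tuple RT] (@vdm_wt m : _ -> RT).
Proof. by apply: measurable_funM; [exact: measurable_vdm|exact: measurable_wt]. Qed.

Lemma measurable_kern m q : 0 <= q ->
  measurable_fun [set: RT * m.-tuple RT] (fun z => kern q z.1 z.2 : RT).
Proof.
move=> q0.
have mQ : measurable_fun [set: RT * m.-tuple RT] (fun z => q * prodch z.2 : RT).
  apply: measurable_funM => //; apply: measurableT_comp; last exact: measurable_snd.
  exact: measurable_prodch.
have Q0 (z : RT * m.-tuple RT) : 0 <= q * prodch z.2 by rewrite mulr_ge0 ?prodch_ge0.
have m1 : measurable_fun [set: RT * m.-tuple RT] (fun z => z.1 : RT) by exact: measurable_fst.
have mh : measurable_fun [set: RT * m.-tuple RT] (fun z => halfangle (q * prodch z.2) z.1 :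
  RT).
  exact: measurable_halfangle.
have mW (g : RT * m.-tuple RT -> RT) : measurable_fun [set: RT * m.-tuple RT] g ->
    measurable_fun [set: RT * m.-tuple RT] (fun z => vdm_wt (tcons (g z, z.2)) : RT).
  move=> mg; apply: measurableT_comp; first exact: measurable_vdm_wt.
  apply: (measurableT_comp (@measurable_tcons _ RT m)).
  by apply: measurable_fun_pair => //; exact: measurable_snd.
apply: measurable_funM.
  apply: measurable_boolR; apply: measurable_and; apply: measurable_fun_ltr => //.
  exact: measurable_funM.
apply: measurable_funM; first exact: measurable_chord_jac.
apply: measurable_funD; first exact: mW.
apply: mW; apply: measurableT_comp mh; exact: oppr_measurable.
Qed.

Lemma measurable_kernr m q y : 0 <= q ->
  measurable_fun [set: m.-tuple RT] (fun t => kern q y t : RT).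
Proof.
move=> q0.
rewrite -[X in measurable_fun _ X]/((fun z : RT * m.-tuple RT => kern q z.1 z.2 : RT) \o
  pair y).
apply: measurableT_comp; first exact: measurable_kern.
exact: measurable_fun_pair.
Qed.

End kernel.

(** * Density of the product of chords under [vdm] *)

Section pushforward_density.
Context (R : realType).
Local Notation RT := (measurableTypeR R).
Local Notation mu := (@lebesgue_measure R).
Local Notation lam := (lebesgue_tuple R).
Local Open Scope ereal_scope.

Let ge0_integral_kern m (q : R) (f : RT -> \bar R) (t : m.-tuple RT) : (0 < q)%R ->
  measurable_fun [set: RT] f -> (forall x, 0 <= f x) ->
  \int[mu]_(x in `](- pi)%R, pi[) (f (q * prodch (tcons (x, t)))%R * (vdm_wt (tcons (x,
    t)))%:E) =
  \int[mu]_y (f y * (kern q y t)%:E).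
Proof.
move=> q0 mf f0.
(* The substitution requires [prodch t > 0]. When [prodch t = 0] both sides are [0]: on the right no
   [y] satisfies [0 < y < 0]. *)
have := prodch_ge0 t; rewrite le_eqVlt => /predU1P[/esym t0|t0].
  rewrite integral0_eq => [|x _]; last by rewrite vdm_wt_eq0// mule0.
  rewrite integral0_eq// => y _; rewrite /kern t0 mulr0 mul0r.
  by case: (ltgtP 0%R y) => // _; rewrite mul0r mule0.
have mW (s : RT -> RT) : measurable_fun [set: RT] s ->
    measurable_fun [set: RT] (fun x => vdm_wt (tcons (s x, t)) : RT).
  move=> ms; apply: measurableT_comp; first exact: measurable_vdm_wt.
  apply: (measurableT_comp (@measurable_tcons _ RT m)).
  exact: measurable_fun_pair.
transitivity (\int[mu]_(x in `](- pi)%R, pi[)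
    (f (q * prodch t * chord x)%R * (vdm_wt (tcons (x, t)))%:E)).
  by apply: eq_integral => x _; rewrite prodch_tcons -mulrA [(prodch t * _)%R]mulrC.
rewrite (@ge0_integral_chord R _ _ (fun x => vdm_wt (tcons (x, t))))//.
- rewrite integral_mkcond; apply: eq_integral => y _; rewrite patchE /kern mem_setE in_itv/=.
  by case: ifPn => _; rewrite ?mul1r// mul0r mule0.
- exact: mulr_gt0.
- exact: mW.
- by move=> x; exact: vdm_wt_ge0.
Qed.

(** The factor [m.+1] counts the choices of the angle with the smallest chord. *)
Definition kern_density m (q y : R) : \bar R :=
  m.+1%:R%:E * \int[lam m]_(t in @angle_cube R m) (kern q y t)%:E.

(** After symmetrization the first angle is integrated innermost, [ge0_integral_kern] trades it for
    the value [y] of [q * prodch], and Tonelli makes [y] the outer variable. *)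
Lemma ge0_integral_prodch m (q : R) (f : RT -> \bar R) : (0 < q)%R ->
  measurable_fun [set: RT] f -> (forall x, 0 <= f x) ->
  \int[lam m.+1]_(t in @angle_cube R m.+1) (f (q * prodch t)%R * (vdm t)%:E) =
  \int[mu]_(y in `]0%R, +oo[) (f y * kern_density m q y).
Proof.
move=> q0 mf f0; have q0' := ltW q0.
pose F := (fun t : m.+1.-tuple RT => f (q * prodch t)%R * (vdm t)%:E) \_ (@angle_cube R m.+1).
have F0 t : 0 <= F t.
  by rewrite /F patchE; case: ifP => // _; rewrite mule_ge0// lee_fin vdm_ge0.
have mF : measurable_fun [set: m.+1.-tuple RT] F.
  apply/(measurable_restrictT _ _).1; first exact: measurable_angle_cube.
  apply: measurable_funTS; apply: emeasurable_funM; last by apply/measurable_EFinP;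
    exact: measurable_vdm.
  apply: measurableT_comp => //; apply: measurable_funM => //; exact: measurable_prodch.
(* The cube, [vdm] and [prodch] are invariant under permutations of the angles. *)
rewrite integral_mkcond -/F ge0_integral_wt//; last first.
  move=> s t; rewrite /F !patchE prodch_perm vdm_perm; congr (if _ then _ else _).
  apply/idP/idP => /set_mem H; apply/mem_set => i.
    by have := H ((s^-1)%g i); rewrite tnth_mktuple permKV.
  by rewrite tnth_mktuple; exact: H.
have mFw : measurable_fun [set: m.+1.-tuple RT] (fun t => F t * (wt t)%:E).
  by apply: emeasurable_funM => //; apply/measurable_EFinP; exact: measurable_wt.
rewrite ge0_integral_tcons//; last by move=> t; rewrite mule_ge0// lee_fin wt_ge0.
pose H (z : RT * m.-tuple RT) : \bar R :=
  f z.1 * (kern q z.1 z.2 * (z.2 \in @angle_cube R m)%:R)%:E.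
have H0 z : 0 <= H z by rewrite mule_ge0// lee_fin mulr_ge0// kern_ge0.
have mH : measurable_fun [set: RT * m.-tuple RT] H.
  apply: emeasurable_funM; first exact: measurableT_comp mf measurable_fst.
  apply/measurable_EFinP; apply: measurable_funM; first exact: measurable_kern.
  apply: (@measurableT_comp _ _ _ _ _ _ (\1_(@angle_cube R m) : m.-tuple RT -> RT)).
    by apply: measurable_indic; exact: measurable_angle_cube.
  exact: measurable_snd.
transitivity (m.+1%:R%:E * \int[lam m]_t \int[mu]_y H (y, t)).
  congr (_ * _); apply: eq_integral => t _.
  have [tc|tc] := boolP (t \in @angle_cube R m); last first.
    rewrite !integral0_eq// => x _; first by rewrite /H (negbTE tc) mulr0 mule0.
    by rewrite /F patchE angle_cube_tcons (negbTE tc) andbF mul0e.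
  transitivity (\int[mu]_y (f y * (kern q y t)%:E)); last first.
    by apply: eq_integral => y _; rewrite /H tc mulr1.
  rewrite -ge0_integral_kern// [RHS]integral_mkcond; apply: eq_integral => x _.
  rewrite /F !patchE angle_cube_tcons tc andbT mem_setE.
  by case: ifPn => _; rewrite ?mul0e// -muleA.
rewrite -(@fubini_tonelli _ _ _ _ R mu (lam m) H)//.
rewrite -ge0_integralZl//; last 2 first.
- exact: measurable_fun_fubini_tonelli_F.
- by move=> y _; exact: integral_ge0.
rewrite [RHS]integral_mkcond; apply: eq_integral => y _.
(* The kernel contains the indicator of [0 < y], so only the open half-line contributes. *)
rewrite patchE mem_setE in_itv/= andbT; case: ifPn => y0; last first.
  rewrite integral0_eq ?mule0// => t _; rewrite /H /kern (negbTE y0)/=.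
  by rewrite !mul0r mule0.
rewrite /kern_density muleCA; congr (_ * _).
have mk : measurable_fun [set: m.-tuple RT] (fun t => (kern q y t)%:E).
  by apply/measurable_EFinP; exact: measurable_kernr.
rewrite -ge0_integralZl//; last 3 first.
- exact: measurable_angle_cube.
- exact: measurable_funTS.
- by move=> t _; rewrite lee_fin kern_ge0.
rewrite [RHS]integral_mkcond; apply: eq_integral => t _.
by rewrite /H/= patchE; case: ifPn => _; rewrite ?mulr1// mulr0 mule0.
Qed.

End pushforward_density.

(** * Bound and pointwise limit of the kernel at [0] *)

Section kernel_limit.
Context (R : realType).
Local Notation RT := (measurableTypeR R).
Local Notation mu := (@lebesgue_measure R).
Local Notation lam := (lebesgue_tuple R).

Lemma halfangleE (Q y : R) : 0 < Q -> 0 < y < Q * 2 -> halfangle Q y = 2 * asin (y / (Q * 2)).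
Proof.
move=> Q0 /andP[y0 yQ]; rewrite /halfangle patchE ifT// inE/= in_itv/=.
by rewrite ltr_pdivrMr ?mulr_gt0// mul1r yQ andbT (@lt_trans _ _ 0)// divr_gt0// mulr_gt0.
Qed.

Lemma chord_halfangle (Q y : R) : 0 < Q -> 0 < y < Q * 2 -> chord (halfangle Q y) = y / Q.
Proof.
move=> Q0 yQ; rewrite halfangleE// chordE mulrAC divff// mul1r.
have /andP[y0 yQ2] := yQ.
have s0 : 0 < y / (Q * 2) by rewrite divr_gt0// mulr_gt0.
have s1 : y / (Q * 2) < 1 by rewrite ltr_pdivrMr ?mulr_gt0// mul1r.
rewrite asinK ?in_itv/=; last by apply/andP; split; lra.
by rewrite gtr0_norm//; field; rewrite gt_eqF.
Qed.

Lemma prodch_le m (t : m.-tuple RT) : prodch t <= 2 ^+ m.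
Proof.
rewrite -[m in leRHS]card_ord -prodr_const; apply: ler_prod => j _.
by rewrite chord_ge0 chord_le2.
Qed.

Lemma vdm_bound m : exists C : R, 0 <= C /\ forall t : m.-tuple RT, vdm t <= C.
Proof.
exists (\prod_(k < m) \prod_(l < m | (k < l)%N) 4 ^+ 2); split.
  by apply: prodr_ge0 => k _; apply: prodr_ge0.
move=> t; apply: ler_prod => k _; apply/andP; split.
  by apply: prodr_ge0 => l _; rewrite sqr_ge0.
apply: ler_prod => l _; rewrite sqr_ge0/= ler_pXn2r ?nnegrE ?gap_ge0//.
rewrite (le_trans (gap_le_chord _ _))//.
by have := chord_le2 (tnth t k); have := chord_le2 (tnth t l); lra.
Qed.

(** The weight is nonzero only where the first chord [y / Q] is smallest; for [y < q] this keeps it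
    below [1], away from the singularity of the Jacobian at [2]. The remaining factor [1 / Q] is
    absorbed by [vdm_wt_le]. *)
Lemma kern_bound m (q : R) : 0 < q ->
  exists C, forall y (t : m.-tuple RT), 0 < y < q -> kern q y t <= C.
Proof.
move=> q0; have [C [C0 vdmC]] := vdm_bound m.
have B0 : 0 <= 2 / q * (4 ^+ m * 2 ^+ m * C *+ 2).
  by rewrite mulr_ge0 ?divr_ge0 ?(ltW q0)// mulrn_wge0// !mulr_ge0.
exists (2 / q * (4 ^+ m * 2 ^+ m * C *+ 2)) => y t /andP[y0 yq].
rewrite /kern; set Q := q * prodch t.
have [yQ|_] := boolP (0 < y < Q * 2); last by rewrite mul0r.
rewrite mul1r.
have Q0 : 0 < Q by case/andP: yQ => ? ?; lra.
have t0 : 0 < prodch t by rewrite -(pmulr_rgt0 _ q0).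
have chordE1 := chord_halfangle Q0 yQ.
have chordE2 : chord (- halfangle Q y) = y / Q by rewrite chordN.
have W x : chord x = y / Q -> vdm_wt (tcons (x, t)) <= 
  prodch t * (4 ^+ m * 2 ^+ m * C) * [forall j, y / Q <= chord (tnth t j)]%:R.
  move=> xE; rewrite (le_trans (vdm_wt_le _ _))// xE ler_wpM2r//.
  (* One factor [prodch t] is kept to cancel that of [1 / Q]; the other is bounded by [2 ^+ m]. *)
  have -> : 4 ^+ m * prodch t ^+ 2 * vdm t = prodch t * 4 ^+ m * (prodch t * vdm t) by ring.
  have -> : prodch t * (4 ^+ m * 2 ^+ m * C) = prodch t * 4 ^+ m * (2 ^+ m * C) by ring.
  rewrite ler_wpM2l ?mulr_ge0 ?exprn_ge0 ?(ltW t0)//.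
  by rewrite ler_pM ?(ltW t0) ?vdm_ge0 ?prodch_le.
have /le_trans W2 := lerD (W _ chordE1) (W _ chordE2).
have jac0 : 0 <= chord_jac Q y by rewrite chord_jac_ge0// ltW.
rewrite (le_trans (ler_wpM2l jac0 (W2 _ (lexx _))))//.
case: (boolP [forall j, y / Q <= chord (tnth t j)]) => [|_]; last first.
  by rewrite !mulr0 addr0 mulr0.
move=> /forallP ymin.
(* Otherwise every chord of [t] would be at least [1], so [prodch t >= 1] and [Q >= q > y], a
   contradiction. *)
have r1 : y / Q < 1.
  rewrite ltNge; apply/negP => r1.
  have t1 : 1 <= prodch t.
    rewrite -[leLHS](_ : \prod_(j < m) 1 = 1); last by rewrite big1.
    by apply: ler_prod => j _; rewrite ler01/= (le_trans r1).
  have : y / Q < 1.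
    rewrite ltr_pdivrMr// mul1r (lt_le_trans yq)// /Q ler_peMr// ltW//.
  by rewrite ltNge r1.
have s0 : 0 <= y / (Q * 2) by rewrite divr_ge0 ?(ltW y0)// mulr_ge0// ltW.
have s1 : y / (Q * 2) <= 1 / 2.
  have -> : y / (Q * 2) = y / Q / 2 by field; rewrite gt_eqF.
  by rewrite ler_pM2r// ltW.
(* As [y / (Q * 2) <= 1 / 2], the square root is at least [1 / 2]. *)
have jac : chord_jac Q y <= 2 / Q.
  have -> : 2 / Q = (Q * (1 / 2))^-1 by field; rewrite gt_eqF.
  rewrite /chord_jac lef_pV2 ?posrE; last 2 first.
  - by rewrite mulr_gt0// sqrtr_gt0 subr_gt0 -[ltRHS](expr1n _ 2) ltr_pXn2r ?nnegrE//; lra.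
  - by rewrite mulr_gt0.
  rewrite ler_pM2l// -[leLHS]ger0_norm// -sqrtr_sqr ler_wsqrtr//.
  by rewrite !expr2; nra.
rewrite !mulr1 -mulr2n (le_trans (ler_wpM2r _ jac))//.
  by rewrite mulrn_wge0// mulr_ge0 ?(ltW t0)// !mulr_ge0// exprn_ge0.
have cancel_prodch (p K : R) : p != 0 -> 2 / (q * p) * (p * K *+ 2) = 2 / q * (K *+ 2).
  by move=> p0; field; rewrite p0 gt_eqF.
by rewrite cancel_prodch// gt_eqF.
Qed.

(** At a strict minimum [nmin] counts only the first angle, whose weight is then [1]. *)
Lemma vdm_wt_min m x (t : m.-tuple RT) : (forall j, chord x < chord (tnth t j)) ->
  vdm_wt (tcons (x, t)) = \prod_(j < m) gap x (tnth t j) ^+ 2 * vdm t.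
Proof.
move=> xmin; rewrite /vdm_wt vdm_tcons /wt /nmin big_ord_recl.
rewrite argmin_tcons (_ : [forall _, _]); last by apply/forallP => j; exact: ltW.
suff -> : \sum_(j < m) argmin_ind (tcons (x, t)) (lift ord0 j) = 0.
  by rewrite /= addr0 divr1 mulr1.
apply: big1 => j _; rewrite argmin_indE.
rewrite (_ : [forall _, _] = false)//; apply/negbTE/negP => /forallP/(_ ord0).
by rewrite tnth_tconsS leNgt xmin.
Qed.

Lemma continuous_prod_gap m (t : m.-tuple RT) :
  continuous (fun x : R => \prod_(j < m) gap x (tnth t j) ^+ 2).
Proof.
apply: continuous_big => [|j _ x]; first exact: mul_continuous.
exact: cvgM (@continuous_gap R (tnth t j) x) (@continuous_gap R (tnth t j) x).
Qed.

(** As [y] decreases to [0] both angles tend to [0], where the distances to the other points become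
    their chords: each summand tends to [prodch t ^+ 2 * vdm t] and the Jacobian to
    [1 / (q * prodch t)]. *)
Lemma kern_cvg m (q : R) (t : m.-tuple RT) : 0 < q ->
  kern q y t @[y --> 0^'+] --> 2 * vdm t * prodch t / q.
Proof.
move=> q0; have := prodch_ge0 t; rewrite le_eqVlt => /predU1P[/esym t0|t0].
  rewrite t0 mulr0 mul0r; apply: cvg_near_cst; apply: nearW => y.
  by rewrite /kern t0 mulr0 mul0r; case: (ltgtP 0 y) => // _; rewrite mul0r.
pose Q := q * prodch t; have Q0 : 0 < Q by exact: mulr_gt0.
have tj0 j : 0 < chord (tnth t j).
  rewrite lt_neqAle chord_ge0 andbT; apply/eqP => tj.
  by move: t0; rewrite /prodch (bigD1 j)//= -tj mul0r ltxx.
pose a (y : R) : R := 2 * asin (y / (Q * 2)).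
pose G (x : R) : R := \prod_(j < m) gap x (tnth t j) ^+ 2 * vdm t.
(* [E] is the kernel with the weights replaced by [1] and the cutoffs removed; it is continuous at
   [0]. *)
pose E (y : R) : R := (Q * Num.sqrt (1 - (y / (Q * 2)) ^+ 2))^-1 * (G (a y) + G (- a y)).
have E0 : E 0 = 2 * vdm t * prodch t / q.
  have a0 : a 0 = 0.
    rewrite /a mul0r -[X in asin X](@sin0 R) sinK ?mulr0// in_itv/=.
    by have := pi_gt0 R => ?; apply/andP; split; lra.
  rewrite /E a0 oppr0 mul0r expr0n/= subr0 sqrtr1 mulr1 /G.
  rewrite (eq_bigr (fun j => chord (tnth t j) ^+ 2)) => [|j _]; last by rewrite gap0.
  rewrite prodrXl -/(prodch t) /Q; field.
  by rewrite !gt_eqF.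
have cE : E y @[y --> 0] --> E 0.
  have cs : (y / (Q * 2)) @[y --> 0] --> 0 / (Q * 2).
    by apply: cvgM; [exact: cvg_id|exact: cvg_cst].
  have ca : a y @[y --> 0] --> a 0.
    apply: cvgM; first exact: cvg_cst.
    apply: cvg_comp; first exact: cs.
    by rewrite mul0r; apply: continuous_asin; apply/andP; split; lra.
  have cG : continuous G.
    by move=> x; apply: cvgM; [exact: continuous_prod_gap|exact: cvg_cst].
  apply: cvgM.
    apply: cvgV; first by rewrite mul0r expr0n/= subr0 sqrtr1 mulr1 gt_eqF.
    apply: cvgM; first exact: cvg_cst.
    apply: cvg_comp; last exact: sqrt_continuous.
    apply: cvgB; first exact: cvg_cst.
    by rewrite expr2; apply: cvgM.
  apply: cvgD; first by apply: cvg_comp; [exact: ca|exact: cG].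
  by apply: cvg_comp; [apply: cvgN; exact: ca|exact: cG].
(* The finitely many chords of [t] are positive, so the first angle eventually has strictly the
   smallest one, and the kernel coincides with [E]. *)
have ymin' : \forall y \near (0 : R)^'+, forall j, y / Q < chord (tnth t j).
  apply: filter_forall => j; near=> y; rewrite ltr_pdivrMr// mulrC; near: y.
  by apply: nbhs_right_lt; rewrite mulr_gt0.
rewrite -E0; move/cvg_at_right_filter: cE; apply: cvg_trans.
apply: near_eq_cvg; near=> y.
have yQ : 0 < y < Q * 2.
  apply/andP; split; near: y; first exact: nbhs_right_gt.
  by apply: nbhs_right_lt; rewrite mulr_gt0.
have ymin j : y / Q < chord (tnth t j) by move: j; near: y; exact: ymin'.
rewrite /kern yQ mul1r /E /chord_jac.
rewrite !vdm_wt_min; first by rewrite halfangleE.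
- by move=> j; rewrite chordN chord_halfangle.
- by move=> j; rewrite chord_halfangle.
Unshelve. all: end_near. Qed.

End kernel_limit.

(** * Positive limit of the density at [0] *)

Section density_limit.
Context (R : realType).
Local Notation RT := (measurableTypeR R).
Local Notation mu := (@lebesgue_measure R).
Local Notation lam := (lebesgue_tuple R).

Lemma chord_gt0 (x : R) : 0 < x < 1 -> 0 < chord x.
Proof.
move=> /andP[x0 x1]; have := pi_ge2 R => ?.
by have /andP[] : 0 < chord x < 2 by apply: chord_pi; rewrite in_itv/=; apply/andP; split; lra.
Qed.

Lemma gap_gt0 (x y : R) : 0 < x < 1 -> 0 < y < 1 -> x != y -> 0 < gap x y.
Proof.
move=> /andP[x0 x1] /andP[y0 y1] xy; rewrite lt_neqAle gap_ge0 andbT eq_sym.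
(* The cosine alone separates the points, being injective on [[0, pi]], which contains [(0, 1)]. *)
rewrite -(sqrf_eq0 (gap x y)) gap_sqr paddr_eq0 ?sqr_ge0// negb_and; apply/orP; left.
rewrite sqrf_eq0 subr_eq0; apply: contra xy => /eqP /cos_inj -> //; have := pi_ge2 R => ?.
- by rewrite in_itv/=; apply/andP; split; lra.
- by rewrite in_itv/=; apply/andP; split; lra.
Qed.

Lemma vdm_prodch_gt0 m (t : m.-tuple RT) :
  (forall i, 0 < tnth t i < 1) -> injective (tnth t) -> 0 < vdm t /\ 0 < prodch t.
Proof.
move=> t01 tinj; split; last by apply: prodr_gt0 => j _; exact: chord_gt0.
apply: prodr_gt0 => k _; apply: prodr_gt0 => l kl; rewrite exprn_gt0// gap_gt0//.
by apply/eqP => /tinj kl'; rewrite kl' ltnn in kl.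
Qed.

Lemma integral_cube_lty m (f : m.-tuple RT -> R) (C : R) :
  measurable_fun [set: m.-tuple RT] (f : _ -> RT) ->
  (forall t, 0 <= f t <= C) -> (\int[lam m]_(t in @angle_cube R m) (f t)%:E < +oo)%E.
Proof.
move=> mf fC; apply: (@le_lt_trans _ _ (\int[lam m]_(t in @angle_cube R m) C%:E)%E).
  apply: ge0_le_integral => //.
  - exact: measurable_angle_cube.
  - by move=> t _; rewrite lee_fin; case/andP: (fC t).
  - by apply/measurable_EFinP; exact: measurable_funTS.
  - by move=> t _; rewrite lee_fin; case/andP: (fC t).
rewrite integral_cst; last exact: measurable_angle_cube.
(* [C >= 0] follows from the bounds on [f] at any one tuple. *)
by rewrite lte_mul_pinfty ?angle_cube_lty// lee_fin;
  case/andP: (fC [tuple 0 | i < m]) => /le_trans; exact.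
Qed.

Lemma kern_density_ge0 m (q y : R) : 0 <= q -> (0 <= kern_density m q y)%E.
Proof.
move=> q0; rewrite /kern_density mule_ge0// integral_ge0// => t _.
by rewrite lee_fin kern_ge0.
Qed.

Lemma measurable_kern_density m (q : R) : 0 <= q ->
  measurable_fun [set: RT] (kern_density m q : RT -> \bar R).
Proof.
move=> q0; apply: emeasurable_funM; first exact: measurable_cst.
pose H (z : RT * m.-tuple RT) : \bar R := (kern q z.1 z.2 * (z.2 \in @angle_cube R m)%:R)%:E.
have mH : measurable_fun [set: RT * m.-tuple RT] H.
  apply/measurable_EFinP; apply: measurable_funM; first exact: measurable_kern.
  apply: (@measurableT_comp _ _ _ _ _ _ (\1_(@angle_cube R m) : m.-tuple RT -> RT)).
    by apply: measurable_indic; exact: measurable_angle_cube.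
  exact: measurable_snd.
have H0 z : (0 <= H z)%E by rewrite lee_fin mulr_ge0// kern_ge0.
rewrite (_ : (fun _ => _) = fubini_F (lam m) H).
  exact: measurable_fun_fubini_tonelli_F.
apply/funext => y; rewrite /fubini_F [LHS]integral_mkcond; apply: eq_integral => t _.
by rewrite patchE /H; case: ifPn => _; rewrite ?mulr1// mulr0.
Qed.

(** Dominated convergence along sequences, with the constant of [kern_bound] on a cube of finite
    measure; the integral of the limit is positive by [integral_cube_gt0]. *)
Lemma kern_density_cvg m (q : R) : 0 < q ->
  exists L : R, 0 < L /\ fine (kern_density m q y) @[y --> 0^'+] --> L.
Proof.
move=> q0; have q0' := ltW q0.
pose l (t : m.-tuple RT) : R := 2 * vdm t * prodch t / q.
have ml : measurable_fun [set: m.-tuple RT] (l : _ -> RT).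
  apply: measurable_funM => //; apply: measurable_funM; last exact: measurable_prodch.
  by apply: measurable_funM => //; exact: measurable_vdm.
have l0 t : 0 <= l t by rewrite divr_ge0// !mulr_ge0 ?vdm_ge0 ?prodch_ge0.
have [C [C0 vdmC]] := vdm_bound R m.
have lC t : 0 <= l t <= 2 * C * 2 ^+ m / q.
  rewrite l0/= ler_pM2r ?invr_gt0// ler_pM ?mulr_ge0 ?vdm_ge0 ?prodch_ge0 ?prodch_le//.
  by rewrite ler_pM2l.
have Ilty := integral_cube_lty ml lC.
have Igt0 : (0 < \int[lam m]_(t in @angle_cube R m) (l t)%:E)%E.
  apply: integral_cube_gt0 => // t t01 tinj; have [v0 p0] := vdm_prodch_gt0 t01 tinj.
  by rewrite divr_gt0// !mulr_gt0.
have Ifin : (\int[lam m]_(t in @angle_cube R m) (l t)%:E)%E \is a fin_num.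
  by rewrite ge0_fin_numE// ltW.
exists (m.+1%:R * fine (\int[lam m]_(t in @angle_cube R m) (l t)%:E)%E); split.
  by rewrite mulr_gt0// fine_gt0// Igt0.
have [B kernB] := kern_bound m q0.
apply/cvg_at_rightP => u [u0 ucvg].
(* The domination holds only below [q], so the sequence is shifted by [N]. *)
have [N _ uN] : \forall n \near \oo, u n < q by apply: cvgr_lt ucvg _ q0.
rewrite -(cvg_shiftn N); apply: fine_cvg.
rewrite EFinM fineK//.
apply: cvgeZl => //.
have [] := @dominated_convergence _ _ _ (lam m) (@angle_cube R m) (@measurable_angle_cube R m)
  (fun n t => (kern q (u (n + N)%N) t)%:E) (EFin \o l) (cst B%:E).
- by move=> n; apply: measurable_funTS; apply/measurable_EFinP; exact: measurable_kernr.
- by apply/measurable_EFinP; exact: measurable_funTS.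
- apply: aeW => t _; apply: cvg_EFin; first by apply: nearW.
  rewrite (cvg_shiftn N (fun n => kern q (u n) t)).
  by have /cvg_at_rightP := @kern_cvg R m q t q0; apply.
- apply: measurable_bounded_integrable.
  + exact: measurable_angle_cube.
  + exact: angle_cube_lty.
  + exact: measurable_cst.
  + exact: bounded_cst.
- apply: aeW => t n _; rewrite gee0_abs ?lee_fin ?kern_ge0//; apply: kernB.
  by rewrite u0/=; apply: uN => /=; exact: leq_addl.
by [].
Qed.

End density_limit.

(** * The law of the angles and the density of the modulus *)

Section law.
Context (R : realType).
Local Notation RT := (measurableTypeR R).
Local Notation mu := (@lebesgue_measure R).
Local Notation lam := (lebesgue_tuple R).

Lemma measurable_angle_weight p m :
  measurable_fun [set: m.-tuple RT] (@angle_weight R p m : m.-tuple RT -> RT).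
Proof.
rewrite (_ : @angle_weight R p m = fun t : m.-tuple RT => vdm t * prodch t ^+ (2 * p));
  last first.
  by apply/funext => t; rewrite angle_weightE.
apply: measurable_funM; first exact: measurable_vdm.
apply: measurable_funX; exact: measurable_prodch.
Qed.

(** The integral has to be finite as well as positive: [fine] sends [+oo] to [0], whose inverse is
    [0]. *)
Lemma angle_cst_gt0 p m : 0 < angle_cst R p m.
Proof.
have [C [C0 vdmC]] := vdm_bound R m.
have wC (t : m.-tuple RT) : 0 <= angle_weight p t <= C * (2 ^+ m) ^+ (2 * p).
  rewrite angle_weightE mulr_ge0 ?vdm_ge0 ?exprn_ge0 ?prodch_ge0//=.
  rewrite ler_pM ?vdm_ge0 ?exprn_ge0 ?prodch_ge0//.
  by rewrite lerXn2r ?nnegrE ?prodch_ge0 ?exprn_ge0 ?prodch_le.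
rewrite invr_gt0 fine_gt0// (integral_cube_lty (@measurable_angle_weight p m) wC) andbT.
apply: integral_cube_gt0 => [|t|t t01 tinj].
- exact: measurable_angle_weight.
- by case/andP: (wC t).
- have [v0 p0] := vdm_prodch_gt0 t01 tinj.
  by rewrite angle_weightE mulr_gt0// exprn_gt0.
Qed.

Lemma measurable_cmod_ZU p m :
  measurable_fun [set: m.-tuple RT] (fun t => cmod (ZU p t) : RT).
Proof.
rewrite (_ : (fun _ => _) = fun t : m.-tuple RT => p`!%:R * prodch t).
  by apply: measurable_funM => //; exact: measurable_prodch.
by apply/funext => t; rewrite cmod_ZU.
Qed.

Definition ZU_density p m (y : R) : R :=
  angle_cst R p m.+1 / p`!%:R ^+ (2 * p) * y ^+ (2 * p) * fine (kern_density m p`!%:R y).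

Lemma ZU_density_ge0 p m y : 0 <= ZU_density p m y.
Proof.
have y0 : 0 <= y ^+ (2 * p) by rewrite exprM exprn_ge0// sqr_ge0.
rewrite /ZU_density mulr_ge0 ?fine_ge0 ?kern_density_ge0//.
by rewrite mulr_ge0// divr_ge0 ?(ltW (angle_cst_gt0 _ _))// exprn_ge0.
Qed.

Lemma measurable_ZU_density p m : measurable_fun [set: RT] (ZU_density p m : RT -> RT).
Proof.
apply: measurable_funM.
  by apply: measurable_funM => //; exact: measurable_funX.
apply: measurableT_comp; first exact: fine_measurable.
exact: measurable_kern_density.
Qed.

Lemma ZU_density_equiv p m : exists2 c : R, 0 < c &
  ZU_density p m ~_(0^'+) (fun eps : R => c * eps ^+ (2 * p)).
Proof.
have q0 : 0 < p`!%:R :> R by rewrite ltr0n fact_gt0.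
have [L [L0 cvgL]] := kern_density_cvg m q0.
pose K := angle_cst R p m.+1 / p`!%:R ^+ (2 * p).
have K0 : 0 < K by rewrite divr_gt0 ?angle_cst_gt0 ?exprn_gt0.
exists (K * L); first exact: mulr_gt0.
apply/eqaddoP => _/posnumP[e].
have eL : 0 < e%:num * L by rewrite mulr_gt0.
move/cvgrPdist_le : cvgL => /(_ _ eL); apply: filterS => y Hy.
rewrite /ZU_density -/K !fctE.
(* The factor [K * y ^+ (2 * p)] is common to the error and to the comparison function, so an error
   [e * L] on the kernel density is enough. *)
have -> : K * y ^+ (2 * p) * fine (kern_density m p`!%:R y) - K * L * y ^+ (2 * p) =
   K * y ^+ (2 * p) * (fine (kern_density m p`!%:R y) - L) by ring.
have -> : K * L * y ^+ (2 * p) = K * y ^+ (2 * p) * L by ring.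
rewrite !normrM -/K [`|L|]gtr0_norm// mulrCA ler_wpM2l ?mulr_ge0//.
by rewrite distrC.
Qed.

(** The factor [prodch t ^+ (2 * p)] is a function of the modulus, so it joins the indicator of [A]
    in the test function [g], and only the weight [vdm] remains. *)
Lemma angle_law_ZU p m (A : set RT) : measurable A ->
  angle_law p ((fun t : m.+1.-tuple RT => cmod (ZU p t)) @^-1` A) =
  (\int[mu]_(x in A `&` `]0%R, +oo[) (ZU_density p m x)%:E)%E.
Proof.
move=> mA; have q0 : 0 < p`!%:R :> R by rewrite ltr0n fact_gt0.
have q0' := ltW q0.
pose K := angle_cst R p m.+1 / p`!%:R ^+ (2 * p).
have K0 : 0 < K by rewrite divr_gt0 ?angle_cst_gt0 ?exprn_gt0.
pose g (y : R) : R := \1_A y * (K * y ^+ (2 * p)).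
have g0 y : 0 <= g y.
  have y0 : 0 <= y ^+ (2 * p) by rewrite exprM exprn_ge0// sqr_ge0.
  by rewrite mulr_ge0// mulr_ge0// ltW.
have mg : measurable_fun [set: RT] (EFin \o g).
  apply/measurable_EFinP; apply: measurable_funM; first exact: measurable_indic.
  by apply: measurable_funM => //; exact: measurable_funX.
have g0' y : (0 <= (EFin \o g) y)%E by rewrite lee_fin.
rewrite /angle_law setIC integral_mkcondr.
transitivity (\int[lam m.+1]_(t in @angle_cube R m.+1)
    ((EFin \o g) (p`!%:R * prodch t)%R * (vdm t)%:E))%E.
  apply: eq_integral => t _; rewrite patchE -EFinM /g indicE.
  have -> : (t \in (fun t : m.+1.-tuple RT => cmod (ZU p t)) @^-1` A) = (p`!%:R * prodch t
    \in A).
    by apply/idP/idP; rewrite !inE/= cmod_ZU.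
  case: ifPn => _; last by rewrite !mul0r.
  have KE : angle_cst R p m.+1 = K * p`!%:R ^+ (2 * p).
    by rewrite /K divfK// expf_neq0// gt_eqF.
  by rewrite mul1r angle_weightE exprMn KE; congr EFin; ring.
rewrite ge0_integral_prodch//.
have mk : measurable_fun [set: RT] (kern_density m p`!%:R : RT -> \bar R).
  exact: measurable_kern_density.
(* The test function [1] shows that the total integral of [kern_density] is that of [vdm] over the
   cube, which is finite. *)
have kfin : {ae mu, forall y, `]0, +oo[%classic y -> kern_density m p`!%:R y \is a fin_num}.
  apply: integrable_ae => //; apply/integrableP; split; first exact: measurable_funTS.
  under eq_integral do rewrite gee0_abs ?kern_density_ge0//.
  have [C [C0 vdmC]] := vdm_bound R m.+1.
  have vC (t : m.+1.-tuple RT) : 0 <= vdm t <= C by rewrite vdm_ge0 vdmC.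
  have vE : (\int[lam m.+1]_(t in @angle_cube R m.+1) (cst 1 (p`!%:R * prodch t)%R * (vdm
    t)%:E) =
      \int[mu]_(y in `]0%R, +oo[) kern_density m p`!%:R y)%E.
    by rewrite ge0_integral_prodch//; apply: eq_integral => y _; rewrite mul1e.
  rewrite -vE; under eq_integral do rewrite mul1e.
  by apply: integral_cube_lty vC; exact: measurable_vdm.
(* Passing to [fine] changes the integrand only on a null set. *)
transitivity (\int[mu]_(y in `]0%R, +oo[) ((\1_A y * ZU_density p m y)%:E))%E.
  apply: ge0_ae_eq_integral => //.
  - by apply: measurable_funTS; apply: emeasurable_funM.
  - apply: measurable_funTS; apply/measurable_EFinP; apply: measurable_funM.
      exact: measurable_indic.
    exact: measurable_ZU_density.
  - by move=> y _; rewrite mule_ge0// kern_density_ge0.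
  - by move=> y _; rewrite lee_fin mulr_ge0// ZU_density_ge0.
  - case: kfin => N [mN N0 subN]; exists N; split => // y; apply: contraPP => yN; apply.
    move=> y0; have kfin : kern_density m p`!%:R y \is a fin_num.
      by apply: contrapT => kinf; apply: yN; apply: subN => /= /(_ y0).
    rewrite -[kern_density _ _ _]fineK//.
    by rewrite -EFinM /g /ZU_density -/K !mulrA.
rewrite setIC [RHS]integral_mkcondr; apply: eq_integral => y _.
by rewrite patchE indicE; case: ifPn => _; rewrite ?mul1r ?mul0r.
Qed.

End law.

Unset Implicit Arguments.

Theorem corollary5p2 (R : realType) (n p : nat) (hp : (1 <= p <= n - 1)%N) :
  exists (c : R) (h : R -> R),
    [/\ 0 < c,
        h ~_(0^'+) (fun eps : R => c * eps ^+ (2 * p))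
      & forall (d : measure_display) (T : measurableType d)
          (P : probability T R)
          (theta : {RV P >-> (n - p).-tuple (measurableTypeR R)}),
        (forall A : set ((n - p).-tuple (measurableTypeR R)), measurable A ->
           distribution P theta A = angle_law p A) ->
        has_density_on P (fun w => cmod (ZU p (theta w))) `]0, +oo[ h].
Proof.
(* The truncated [n - 1] is harmless: [1 <= p] excludes [n = 0]. At least one angle remains to be
   singled out. *)
have : (0 < n - p)%N by rewrite subn_gt0; case/andP: hp => p1 pn; lia.
case: (n - p)%N => // m _.
have [c c0 equiv_c] := ZU_density_equiv R p m.
exists c, (ZU_density p m); split => // d T P theta law; split.
- apply: measurable_funTS; exact: measurable_ZU_density.
- by move=> y _; exact: ZU_density_ge0.
- move=> A mA; rewrite -angle_law_ZU// -law//.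
  rewrite -[X in measurable X]setTI; exact: measurable_cmod_ZU.
Qed.
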